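(* \textsc{BoundedMax Retrieval} can be solved exactly on bidirectional tree instances with $n$ vertices in $O(n^2)$ time.
   Context: A version graph is a directed graph $G=(V,E)$ in which every vertex $v$ has a materialization (storage) cost $s_v\in\mathbb{N}$ and every edge $e=(u,v)$ has a storage cost $s_e\in\mathbb{N}$ and a retrieval cost $r_e\in\mathbb{N}$. A solution consists of a set $M\subseteq V$ of materialized vertices and a set $F\subseteq E$ of stored edges such that every vertex is reachable from some vertex of $M$ by a directed path (possibly of length $0$) with all edges in $F$. Its storage cost is $\sum_{v\in M}s_v+\sum_{e\in F}s_e$; the retrieval cost $R(v)$ is the minimum, over such paths, of the sum of the $r_e$ on the path ($0$ for $v\in M$). \textsc{BoundedMax Retrieval}: given $G$ and a retrieval bound $\mathcal{R}$, find a solution with $\max_vR(v)\le\mathcal{R}$ of minimum storage cost. A bidirectional tree is a version graph obtained from an undirected tree $(V,E_0)$ by including both directed edges $(u,v)$ and $(v,u)$ for each $\{u,v\}\in E_0$, where the costs of the two directions may differ. *)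

(* Defs.v *)
From mathcomp Require Import all_boot.

Set Implicit Arguments.
Unset Strict Implicit.
Unset Printing Implicit Defensive.

Section VersionGraphs.

Variable V : finType.

(* The costs [edge_storage] and [edge_retrieval] are meaningful on edges only;
   their values on other pairs are never used. *)
Record version_graph := VersionGraph {
  edge : rel V;
  vertex_storage : V -> nat;
  edge_storage : V * V -> nat;
  edge_retrieval : V * V -> nat
}.

Record solution := Solution {
  materialized : {set V};
  stored : {set V * V}
}.

(* Undirected simple graphs are symmetric irreflexive relations. *)
Definition is_tree (e0 : rel V) : Prop :=
  [/\ 0 < #|V|, symmetric e0, irreflexive e0,
      forall x y, connect e0 x y
    & forall c : seq V, 2 < size c -> ~ ucycle e0 c].

Variable G : version_graph.

Definition bidirectional_tree : Prop :=
  exists2 e0 : rel V, is_tree e0 & forall u v, edge G u v = e0 u v.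

(* [x :: p] is a path of stored edges from a materialized vertex to [v]. *)
Definition retrieval_path (S : solution) (v x : V) (p : seq V) : Prop :=
  [/\ x \in materialized S,
      path [rel a b | (a, b) \in stored S] x p
    & last x p = v].

Definition path_retrieval (x : V) (p : seq V) : nat :=
  sumn (pairmap (fun a b => edge_retrieval G (a, b)) x p).

Definition is_retrieval_cost (S : solution) (v : V) (k : nat) : Prop :=
  (exists x p, retrieval_path S v x p /\ path_retrieval x p = k) /\
  (forall x p, retrieval_path S v x p -> k <= path_retrieval x p).

Definition is_solution (S : solution) : Prop :=
  (forall e, e \in stored S -> edge G e.1 e.2) /\
  (forall v, exists x p, retrieval_path S v x p).

Definition storage_cost (S : solution) : nat :=
  \sum_(v in materialized S) vertex_storage G v +
  \sum_(e in stored S) edge_storage G e.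

Definition bounded_max_retrieval (Rb : nat) (S : solution) : Prop :=
  exists2 r : V -> nat,
    forall v, is_retrieval_cost S v (r v) & \max_(v : V) r v <= Rb.

Definition bmr_optimal (Rb : nat) (S : solution) : Prop :=
  [/\ is_solution S, bounded_max_retrieval Rb S
    & forall S', is_solution S' -> bounded_max_retrieval Rb S' ->
        storage_cost S <= storage_cost S'].

Definition edge_listing (es : seq (V * V)) : Prop :=
  uniq es /\ forall u v, ((u, v) \in es) = edge G u v.

End VersionGraphs.

(* Model of computation: a unit-cost random access machine with structured
   control flow.  The memory consists of scalar variables and of unbounded
   arrays of natural numbers; a program names its variables and arrays by fixed
   constants, and only the indices into the arrays are computed.  The primitive
   operations are addition, truncated subtraction and comparison; there is
   deliberately no multiplication, which at unit cost would make the model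
   unreasonably powerful. *)
Inductive expr :=
| Const of nat
| Var of nat
| Get of nat & expr
| Add of expr & expr
| Sub of expr & expr
| Eq of expr & expr
| Lt of expr & expr.

Inductive cmd :=
| Skip
| Assign of nat & expr
| Put of nat & expr & expr
| Seq of cmd & cmd
| If of expr & cmd & cmd
| While of expr & cmd.

Record state := State {
  vars : nat -> nat;
  arrs : nat -> nat -> nat
}.

Fixpoint eval (st : state) (e : expr) : nat :=
  match e with
  | Const k => k
  | Var x => vars st x
  | Get a e1 => arrs st a (eval st e1)
  | Add e1 e2 => eval st e1 + eval st e2
  | Sub e1 e2 => eval st e1 - eval st e2
  | Eq e1 e2 => nat_of_bool (eval st e1 == eval st e2)
  | Lt e1 e2 => nat_of_bool (eval st e1 < eval st e2)
  end.

Fixpoint eval_time (e : expr) : nat :=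
  match e with
  | Const _ | Var _ => 1
  | Get _ e1 => (eval_time e1).+1
  | Add e1 e2 | Sub e1 e2 | Eq e1 e2 | Lt e1 e2 =>
      (eval_time e1 + eval_time e2).+1
  end.

Definition set_var (st : state) (x k : nat) : state :=
  State (fun y => if y == x then k else vars st y) (arrs st).

Definition set_arr (st : state) (a i k : nat) : state :=
  State (vars st)
    (fun b j => if (b == a) && (j == i) then k else arrs st b j).

(* [exec c st st' t]: started in [st], the program [c] halts in [st'] after
   exactly [t] elementary steps. *)
Inductive exec : cmd -> state -> state -> nat -> Prop :=
| ExecSkip st : exec Skip st st 1
| ExecAssign st x e :
    exec (Assign x e) st (set_var st x (eval st e)) (eval_time e).+1
| ExecPut st a e1 e2 :
    exec (Put a e1 e2) st (set_arr st a (eval st e1) (eval st e2))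
      (eval_time e1 + eval_time e2).+1
| ExecSeq st st1 st2 c1 c2 t1 t2 :
    exec c1 st st1 t1 -> exec c2 st1 st2 t2 ->
    exec (Seq c1 c2) st st2 (t1 + t2).+1
| ExecIfTrue st st1 e c1 c2 t :
    eval st e != 0 -> exec c1 st st1 t ->
    exec (If e c1 c2) st st1 (eval_time e + t).+1
| ExecIfFalse st st1 e c1 c2 t :
    eval st e = 0 -> exec c2 st st1 t ->
    exec (If e c1 c2) st st1 (eval_time e + t).+1
| ExecWhileFalse st e c :
    eval st e = 0 -> exec (While e c) st st (eval_time e).+1
| ExecWhileTrue st st1 st2 e c t1 t2 :
    eval st e != 0 -> exec c st st1 t1 -> exec (While e c) st1 st2 t2 ->
    exec (While e c) st st2 (eval_time e + t1 + t2).+1.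

Lemma exec_deterministic c st st1 st2 t1 t2 :
  exec c st st1 t1 -> exec c st st2 t2 -> st1 = st2 /\ t1 = t2.
Proof.
move=> H; elim: H st2 t2 => {c st st1 t1}.
- by move=> st st2 t2 H; inversion H.
- by move=> st x e st2 t2 H; inversion H.
- by move=> st a e1 e2 st2 t2 H; inversion H.
- move=> st s1 s2 c1 c2 t1 t2 _ IH1 _ IH2 s3 t3 H.
  inversion H as [| | |? s4 ? ? ? u1 u2 E1 E2| | | |]; subst.
  by have [? ?] := IH1 _ _ E1; subst; have [? ?] := IH2 _ _ E2; subst.
- move=> st s1 e c1 c2 t Ne _ IH s2 t2 H.
  inversion H as [| | | |? ? ? ? ? ? _ E|? ? ? ? ? ? Z _| |]; subst.
    by have [-> ->] := IH _ _ E.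
  by rewrite Z in Ne.
- move=> st s1 e c1 c2 t Z _ IH s2 t2 H.
  inversion H as [| | | |? ? ? ? ? ? Ne _|? ? ? ? ? ? _ E| |]; subst.
    by rewrite Z in Ne.
  by have [-> ->] := IH _ _ E.
- move=> st e c Z s2 t2 H.
  inversion H as [| | | | | |? ? ? _|? ? ? ? ? ? ? Ne _ _]; subst => //.
  by rewrite Z in Ne.
- move=> st s1 s2 e c t1 t2 Ne _ IH1 _ IH2 s3 t3 H.
  inversion H as [| | | | | |? ? ? Z|? ? ? ? ? ? ? _ E1 E2]; subst.
    by rewrite Z in Ne.
  have [? ?] := IH1 _ _ E1; subst.
  by have [-> ->] := IH2 _ _ E2.
Qed.

(* Input: the graph is given by its vertex costs and by a list of its directed
   edges, in an arbitrary order.  Variables 0, 1, 2 hold the number of vertices,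
   the retrieval bound and the number of directed edges; array 0 holds the
   vertex costs; arrays 1, 2, 3, 4 hold the tail, the head, the storage cost and
   the retrieval cost of the i-th edge.  All other cells are 0. *)
Definition input_array (n : nat) (G : version_graph 'I_n)
    (es : seq ('I_n * 'I_n)) (a : nat) : seq nat :=
  match a with
  | 0 => [seq vertex_storage G v | v <- enum 'I_n]
  | 1 => [seq nat_of_ord e.1 | e <- es]
  | 2 => [seq nat_of_ord e.2 | e <- es]
  | 3 => [seq edge_storage G e | e <- es]
  | 4 => [seq edge_retrieval G e | e <- es]
  | _ => [::]
  end.

Definition input_state (n : nat) (G : version_graph 'I_n) (Rb : nat)
    (es : seq ('I_n * 'I_n)) : state :=
  State (fun x => nth 0 [:: n; Rb; size es] x)
        (fun a i => nth 0 (input_array G es a) i).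

(* Output: array 5 flags the materialized vertices, array 6 the stored edges
   (by their position in the input list). *)
Definition output_solution (n : nat) (es : seq ('I_n * 'I_n)) (st : state) :
    solution 'I_n :=
  Solution [set v : 'I_n | arrs st 5 v != 0]
           [set e in es | arrs st 6 (index e es) != 0].

(* Main.v *)
Require Import Defs.
From mathcomp Require Import all_boot zify.

(** A feasible solution lets every vertex [v] be retrieved from a materialized
    vertex [a v] along the tree path, and choosing the nearest source with a
    fixed tie-break makes [a] constant along these paths.  Conversely such an
    assignment determines a solution: materialize the fixed points of [a] and
    store the last edge of each path.  The storage cost becomes a sum of terms
    depending on [(v, a v)] only, and the constraint becomes a condition on the
    pairs [(a w, a (parent w))], so it is minimized by the tree recursion
      [F v u = entry v u + \sum_(w child of v) F w (sel w u)],
    where [sel w u] is the cheaper of [u] and the best source below [w] if [u]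
    lies outside the subtree of [w], and [u] otherwise.  A source violating the
    retrieval bound is charged more than materializing everything costs.  The
    program grows the tree from vertex 0 one vertex at a time, which updates the
    next-hop and distance matrices in linear time per vertex, then evaluates the
    recursion in reverse order and traces the optimal choices back. *)

Set Implicit Arguments.
Unset Strict Implicit.
Unset Printing Implicit Defensive.

(** * Trees grown one vertex at a time *)

Section Growth.

Variables (V : finType) (e : rel V) (rho : V).

Implicit Types (h : seq (V * V)) (r : V * V -> nat).

(* [h] lists the added vertices with their parents, most recent first. *)
Fixpoint dom h : seq V := if h is (x, _) :: h' then x :: dom h' else [:: rho].

(** Insertion time. A parent is older than its children, so decreasing rank visits the tree
    bottom-up and increasing rank top-down. *)
Fixpoint rank h (v : V) : nat :=
  if h is (x, _) :: h' then if v == x then (size h').+1 else rank h' v else 0.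

(* The neighbour of [v] on the path from [v] to [u], and [u] itself if [v = u]. *)
Fixpoint nx h (v u : V) : V :=
  if h is (x, p) :: h' then
    if v == x then if u == x then x else p
    else if u == x then if v == p then x else nx h' v p
    else nx h' v u
  else rho.

(** Length of the directed path from [u] to [v]. The two directions may cost differently, so the
    order of the arguments matters; it is the reverse of that of [nx]. With unit weights this is the
    hop distance, used as an induction measure. *)
Fixpoint dist r h (u v : V) : nat :=
  if h is (x, p) :: h' then
    if v == x then if u == x then 0 else dist r h' u p + r (p, x)
    else if u == x then r (x, p) + dist r h' p v
    else dist r h' u v
  else 0.

(** The last clause carries acyclicity: a new vertex is attached to the current tree in one vertex
    only. *)
Fixpoint growth h : Prop :=
  if h is (x, p) :: h' then
    [/\ growth h', x \notin dom h', p \in dom h', e p x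
      & forall q, q \in dom h' -> e q x -> q = p]
  else True.

Lemma size_dom h : size (dom h) = (size h).+1.
Proof. by elim: h => [|[x p] h /= ->]. Qed.

Lemma root_dom h : rho \in dom h.
Proof. by elim: h => [|[x p] h IH] //=; rewrite inE ?eqxx // IH orbT. Qed.

Lemma growth_uniq h : growth h -> uniq (dom h).
Proof. by elim: h => [|[x p] h IH] //= [g -> _ _ _]; rewrite IH. Qed.

Lemma nx_dom h u v :
  growth h -> u \in dom h -> v \in dom h -> nx h v u \in dom h.
Proof.
elim: h u v => [|[x p] h IH] u v /=; first by rewrite !inE eqxx.
move=> [g nx_ px _ _]; rewrite !inE.
case: (eqVneq u x) => [->|nu] /=; case: (eqVneq v x) => [->|nv] //=.
- by rewrite eqxx.
- by move=> _ vd; case: (eqVneq v p); rewrite ?eqxx // => _; rewrite IH ?orbT.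
- by rewrite px orbT.
- by move=> ud vd; rewrite IH ?orbT.
Qed.

Lemma nx_self h u : u \in dom h -> nx h u u = u.
Proof.
elim: h u => [|[x p] h IH] u /=; first by rewrite inE => /eqP ->.
by rewrite inE; case: (eqVneq u x) => [->|nu] //=; exact: IH.
Qed.

Lemma dist_self r h u : dist r h u u = 0.
Proof. by elim: h u => [|[x p] h IH] u //=; case: (eqVneq u x). Qed.

Lemma notin_neq (s : seq V) x y : x \notin s -> y \in s -> y == x = false.
Proof. by move=> xs ys; apply/negP => /eqP E; rewrite -E ys in xs. Qed.

Hypothesis e_sym : symmetric e.

Lemma nx_edge h u v :
  growth h -> u \in dom h -> v \in dom h -> u != v -> e (nx h v u) v.
Proof.
elim: h u v => [|[x p] h IH] u v /=.
  by rewrite !inE => _ /eqP -> /eqP ->; rewrite eqxx.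
move=> [g xd pd epx _]; rewrite !inE.
case: (eqVneq u x) => [->|nu] /=; case: (eqVneq v x) => [->|nv] //=.
- move=> _ vd _; case: (eqVneq v p) => [->|np]; first by rewrite e_sym.
  by apply: IH => //; rewrite eq_sym.
- by move=> ud vd nuv; apply: IH.
Qed.

(** The recursion of [dist] peels off the youngest vertex; later arguments need to peel off the last
    edge of the path instead. *)
Lemma dist_step r h u v :
  growth h -> u \in dom h -> v \in dom h -> u != v ->
  dist r h u v = dist r h u (nx h v u) + r (nx h v u, v).
Proof.
elim: h u v => [|[x p] h IH] u v /=.
  by rewrite !inE => _ /eqP -> /eqP ->; rewrite eqxx.
move=> [g xd pd epx _]; rewrite !inE.
case: (eqVneq u x) => [->|nu] /=; case: (eqVneq v x) => [->|nv] //=.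
- move=> _ vd _; case: (eqVneq v p) => [->|np].
    by rewrite eqxx dist_self addn0.
  have -> : nx h v p == x = false by rewrite (notin_neq xd) ?nx_dom.
  by rewrite -addnA -IH // eq_sym.
- by move=> ud _ _; rewrite (notin_neq xd pd).
- move=> ud vd nuv.
  have -> : nx h v u == x = false by rewrite (notin_neq xd) ?nx_dom.
  exact: IH.
Qed.

(** Deleting the edge between [z] and [v] splits the tree in two, and [u] lies on exactly one side.
    This is the form in which acyclicity reaches the optimality argument. *)
Lemma nx_turn h u z v :
  growth h -> irreflexive e -> u \in dom h -> z \in dom h -> v \in dom h ->
  e z v -> (nx h v u == z) = ~~ (nx h z u == v).
Proof.
move=> + e_irr; elim: h u z v => [|[x p] h IH] u z v /=.
  by rewrite !inE => _ _ /eqP -> /eqP ->; rewrite e_irr.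
move=> [g xd pd epx only]; rewrite !inE.
have px : p == x = false by exact: notin_neq xd pd.
have xp : x == p = false by rewrite eq_sym.
case: (eqVneq z x) => [->|nz] /=; case: (eqVneq v x) => [->|nv] //=.
- by rewrite e_irr.
- move=> ud _ vd exv.
  have -> : v = p by apply: only => //; rewrite e_sym.
  case: (eqVneq u x) ud => [->|nu] /= ud; first by rewrite !eqxx xp.
  by rewrite eqxx; apply: (notin_neq xd); apply: nx_dom.
- move=> ud zd _ ezx.
  have -> : z = p by apply: only.
  case: (eqVneq u x) ud => [->|nu] /= ud; first by rewrite !eqxx xp.
  by rewrite eqxx (notin_neq xd) ?nx_dom.
- move=> ud zd vd ezv.
  case: (eqVneq u x) ud => [->|nu] /= ud; last exact: IH.
  (* Here [u = x] hangs off [p], so every vertex other than [p] sees it in the direction of [p]; an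
     endpoint equal to [p] is treated apart. *)
  have T := IH _ _ _ g pd zd vd ezv.
  case: (eqVneq v p) T => [Ev|nvp]; case: (eqVneq z p) => [Ez|nzp].
  + by move=> _; move: ezv; rewrite {1}Ez Ev e_irr.
  + rewrite Ev nx_self // [p == z]eq_sym (negbTE nzp) => T.
    by rewrite [x == z]eq_sym (negbTE nz) T.
  + rewrite Ez nx_self // [p == v]eq_sym (negbTE nvp) => ->.
    by rewrite [x == v]eq_sym (negbTE nv).
  + by [].
Qed.

Lemma rank_size h v : rank h v <= size h.
Proof. by elim: h => [|[x p] h IH] //=; case: eqP => // _; exact: leqW. Qed.

Lemma rank_nx h v :
  growth h -> v \in dom h -> v != rho -> rank h (nx h v rho) < rank h v.
Proof.
elim: h v => [|[x p] h IH] v /=; first by rewrite inE => _ /eqP ->; rewrite eqxx.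
move=> [g xd pd _ _]; rewrite inE => vd nv.
have rx : rho == x = false by rewrite (notin_neq xd) ?root_dom.
rewrite rx; case: (eqVneq v x) vd => [_|nvx] /= vd.
  by rewrite (notin_neq xd pd) ltnS rank_size.
by rewrite (notin_neq xd) ?nx_dom ?root_dom // IH.
Qed.

Lemma rank_root h : growth h -> rank h rho = 0.
Proof.
elim: h => [|[x p] h IH] //= [g xd _ _ _].
by rewrite (notin_neq xd) ?root_dom // IH.
Qed.

Lemma rank_inj h u v :
  growth h -> u \in dom h -> v \in dom h -> rank h u = rank h v -> u = v.
Proof.
elim: h => [|[x p] h IH] /=; first by rewrite !inE => _ /eqP -> /eqP ->.
move=> [g _ _ _ _]; rewrite !inE.
case: (eqVneq u x) => [->|nu] /=; case: (eqVneq v x) => [->|nv] //=.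
- by move=> _ _ E; have := rank_size h v; rewrite -E ltnn.
- by move=> _ _ E; have := rank_size h u; rewrite E ltnn.
- exact: IH.
Qed.

Lemma growth_path h u v :
  growth h -> u \in dom h -> v \in dom h ->
  exists p, [/\ path e u p, last u p = v & all (mem (dom h)) p].
Proof.
move=> g ud; have [k] := ubnP (dist (fun _ => 1) h u v).
elim: k v => // k IH v lk vd.
have [<-|nuv] := eqVneq u v; first by exists [::].
have [|p [pp pl pa]] := IH (nx h v u) _ (nx_dom g ud vd).
  by move: lk; rewrite (dist_step _ g ud vd nuv) addn1.
exists (rcons p v); rewrite rcons_path pp pl last_rcons all_rcons pa nx_edge //.
by rewrite /= vd.
Qed.

(* Two edges from a new vertex into the connected set [dom h] would close a cycle. *)
Lemma growth_only_edge h x p q :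
  growth h -> (forall c : seq V, 2 < size c -> ~ ucycle e c) ->
  x \notin dom h -> p \in dom h -> e p x ->
  q \in dom h -> e q x -> q = p.
Proof.
move=> g acyc xd pd epx qd eqx; apply/eqP/negPn/negP => nqp.
have [s [ps ls alls]] := growth_path g pd qd.
case/shortenP: ps ls alls => s' ps' us' sub ls' alls.
apply: (acyc (x :: p :: s')).
  by case: s' ls' nqp {ps' us' sub} => //= ->; rewrite eqxx.
rewrite /ucycle /= e_sym epx rcons_path ps' ls' eqx.
suff -> : x \notin p :: s' by [].
rewrite inE negb_or eq_sym (notin_neq xd pd) /=.
by apply/negP => /sub xs; move/allP: alls => /(_ _ xs) /=; apply/negP.
Qed.

End Growth.

(** * Solutions as assignments of sources *)

(** Interface between the grown tree and the optimality argument: [nxt v u] is the neighbour of [v]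
    towards [u], [R u v] the retrieval cost of the tree path, and [H] a measure for inductions along
    that path. *)
Record navigation (V : finType) (e : rel V) (r : V * V -> nat)
    (nxt : V -> V -> V) (R H : V -> V -> nat) : Prop := Navigation {
  nav_sym : symmetric e;
  nav_self : forall u, nxt u u = u;
  nav_edge : forall u v, u != v -> e (nxt v u) v;
  nav_turn : forall u z v, e z v -> (nxt v u == z) = ~~ (nxt z u == v);
  nav_R0 : forall u, R u u = 0;
  nav_RS : forall u v, u != v -> R u v = R u (nxt v u) + r (nxt v u, v);
  nav_HS : forall u v, u != v -> H u (nxt v u) < H u v
}.

Lemma growth_navigation (V : finType) (e : rel V) (r : V * V -> nat) rho h :
  symmetric e -> irreflexive e -> growth e rho h ->
  (forall v, v \in dom rho h) ->
  navigation e r (nx rho h) (dist r h) (dist (fun _ => 1) h).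
Proof.
move=> e_sym e_irr g tot; split=> //.
- by move=> u; apply: nx_self.
- by move=> u v nuv; apply: nx_edge.
- by move=> u z v ezv; apply: nx_turn.
- by move=> u; apply: dist_self.
- by move=> u v nuv; apply: (@dist_step _ e).
- by move=> u v nuv; rewrite [ltnRHS](dist_step (e := e) (rho := rho) _ g) ?tot ?addn1.
Qed.

Lemma path_retrieval_rcons (V : finType) (G : version_graph V) x p v :
  path_retrieval G x (rcons p v) =
  path_retrieval G x p + edge_retrieval G (last x p, v).
Proof.
rewrite /path_retrieval -cats1; elim: p x => [|y p IH] x /=; first by rewrite addn0.
by rewrite IH addnA.
Qed.

Section Assignments.

Variables (V : finType) (G : version_graph V) (Rb : nat).
Variables (nxt : V -> V -> V) (R H : V -> V -> nat).
Hypothesis nav : navigation (edge G) (edge_retrieval G) nxt R H.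

Definition entry_cost (v u : V) : nat :=
  if u == v then vertex_storage G v else edge_storage G (nxt v u, v).

(* [a v] is the materialized vertex from which [v] is retrieved. *)
Definition consistent (a : V -> V) : Prop :=
  forall v, a v != v -> a (nxt v (a v)) = a v.

Definition assignment_solution (a : V -> V) : solution V :=
  Solution [set v | a v == v]
           [set (nxt v (a v), v) | v in [set v | a v != v]].

(** * Stored walks and tree paths *)

Section TreePaths.

Variables (S : solution V) (u : V).

(** No list of vertices is carried: the tree fixes the path from [u] to [v], and only whether its
    edges are stored is in question. *)
Inductive tree_path : V -> Prop :=
| TreePathRefl : tree_path u
| TreePathStep v : u != v -> (nxt v u, v) \in stored S ->
    tree_path (nxt v u) -> tree_path v.

Lemma tree_path_last v :
  tree_path v -> u != v -> (nxt v u, v) \in stored S /\ tree_path (nxt v u).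
Proof. by case=> // ; rewrite eqxx. Qed.

Lemma tree_path_walk v :
  tree_path v ->
  exists p, [/\ path [rel a b | (a, b) \in stored S] u p, last u p = v
              & path_retrieval G u p = R u v].
Proof.
elim=> [|{}v nuv sv _ [p [pp lp cp]]].
  by exists [::]; split=> //; rewrite (nav_R0 nav).
exists (rcons p v); rewrite rcons_path last_rcons pp lp path_retrieval_rcons /=.
by rewrite lp cp -(nav_RS nav).
Qed.

Hypothesis S_edges : forall e, e \in stored S -> edge G e.1 e.2.

(* A last step of the walk that does not follow the tree path to its end
   retreats along it. *)
Lemma walk_tree_path v p :
  path [rel a b | (a, b) \in stored S] u p -> last u p = v ->
  tree_path v /\ R u v <= path_retrieval G u p.
Proof.
elim/last_ind: p v => [|p y IH] v.
  by move=> _ /= <-; rewrite (nav_R0 nav); split=> //; constructor.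
rewrite rcons_path last_rcons path_retrieval_rcons => /andP[pp /= sy] <-.
have [tz cz] := IH _ pp erefl; set z := last u p in sy tz cz *.
have [<-|nuy] := eqVneq u y; first by split; [constructor | rewrite (nav_R0 nav)].
have T := nav_turn nav u (S_edges sy).
have [E|ne] := eqVneq (nxt y u) z.
  split; first by constructor; rewrite ?E.
  by rewrite (nav_RS nav nuy) E leq_add2r.
move: T; rewrite /= (negbTE ne) => /esym/negbFE/eqP E.
have nuz : u != z.
  by apply: contraNneq nuy => uz; rewrite -E -uz (nav_self nav).
have [t' le'] : tree_path y /\ R u y <= R u z.
  split; last by rewrite (nav_RS nav nuz) E leq_addr.
  by rewrite -E; have [] := tree_path_last tz nuz.
by split=> //; apply: leq_trans le' _; apply: leq_trans cz (leq_addr _ _).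
Qed.

End TreePaths.

(** * From a solution to a consistent assignment *)

Section Nearest.

Variable S : solution V.
Hypothesis solS : is_solution G S.

Let src (u v : V) :=
  (u \in materialized S) && connect [rel a b | (a, b) \in stored S] u v.

(* The rank breaks ties, so that sources are inherited along tree paths. *)
Let key (u v : V) := R u v * #|V| + enum_rank u.

(** A key is a two-digit number in base [#|V|] with the distance as leading digit, so an order
    between keys passes to the leading digits. *)
Lemma mulnD_ord_leq (m i j x y : nat) :
  j < m -> x * m + i <= y * m + j -> x <= y.
Proof.
move=> jm le; rewrite leqNgt; apply/negP => lt.
have : y.+1 * m <= x * m by rewrite leq_mul2r lt orbT.
by rewrite mulSn; lia.
Qed.

Lemma key_dist u u' v : key u v <= key u' v -> R u v <= R u' v.
Proof. exact/mulnD_ord_leq/ltn_ord. Qed.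

Let best (u v : V) := src u v && [forall u', src u' v ==> (key u v <= key u' v)].

Lemma best_exists v : exists u, best u v.
Proof.
have [x [p [xm pp lp]]] := solS.2 v.
have s : src x v by rewrite /src xm; apply/connectP; exists p.
case: (arg_minnP (P := fun u => src u v) (fun u => key u v) s) => u su mu.
exists u; rewrite /best su; apply/forallP => u'; apply/implyP; exact: mu.
Qed.

Definition nearest (v : V) : V := odflt v [pick u | best u v].

Lemma nearestP v : best (nearest v) v.
Proof.
rewrite /nearest; case: pickP => //= no; have [u bu] := best_exists v.
by rewrite no in bu.
Qed.

Lemma nearest_src v : src (nearest v) v.
Proof. by have /andP[] := nearestP v. Qed.

Lemma nearest_min u v : src u v -> key (nearest v) v <= key u v.
Proof.
by move=> s; have /andP[_ /forallP/(_ u)/implyP] := nearestP v; exact.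
Qed.

Lemma src_tree_path u v : src u v -> tree_path S u v.
Proof.
move=> /andP[_ /connectP[p pp lp]].
by have [] := walk_tree_path solS.1 pp (esym lp).
Qed.

Lemma tree_path_src u v : u \in materialized S -> tree_path S u v -> src u v.
Proof.
move=> um /tree_path_walk[p [pp lp _]]; rewrite /src um.
by apply/connectP; exists p.
Qed.

Lemma nearest_step v :
  nearest v != v ->
  (nxt v (nearest v), v) \in stored S /\ src (nearest v) (nxt v (nearest v)).
Proof.
move=> ne; have s := nearest_src v; have [um _] := andP s.
have [sv t] := tree_path_last (src_tree_path s) ne.
by split=> //; apply: tree_path_src.
Qed.

(** The source of [v] also serves its predecessor [w], and the source of [w] also serves [v] through
    [w]. Minimality at both vertices forces equal distances, and the tie-break by rank then
    identifies the two sources. *)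
Lemma nearest_consistent : consistent nearest.
Proof.
move=> v ne; have [sv sw] := nearest_step ne.
set u := nearest v in ne sv sw *; set w := nxt v u in sv sw *.
set u' := nearest w; have su' : src u' w := nearest_src w.
have le1 : key u' w <= key u w := nearest_min sw.
have [um' cw'] := andP su'.
have su'v : src u' v.
  by rewrite /src um' (connect_trans cw') //; apply: connect1.
have le2 : key u v <= key u' v := nearest_min su'v.
have [p [pp lp cp]] := tree_path_walk (src_tree_path su').
(* The walk from [u'] to [w] extended by the edge to [v] bounds the tree distance from [u'] to [v],
   whether or not [w] precedes [v] on that tree path. *)
have [_ le3] : tree_path S u' v /\
    R u' v <= path_retrieval G u' (rcons p v).
  by apply: (walk_tree_path solS.1); rewrite ?last_rcons // rcons_path pp lp.
rewrite path_retrieval_rcons cp lp in le3.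
have E := nav_RS nav ne; rewrite -/w in E.
(* The minimality inequalities close up into equalities of distances, which leaves only the ranks to
   compare. *)
have eqR : R u w = R u' w.
  apply/eqP; rewrite eqn_leq (key_dist le1) andbT.
  by have := leq_trans (key_dist le2) le3; rewrite E leq_add2r.
have eqV : R u v = R u' v.
  by apply/eqP; rewrite eqn_leq (key_dist le2) E eqR le3.
apply/enum_rank_inj/val_inj/eqP => /=; move: le1 le2.
by rewrite /key eqV eqR !leq_add2l eqn_leq => -> ->.
Qed.

Lemma nearest_retrieval v : is_retrieval_cost G S v (R (nearest v) v).
Proof.
have s := nearest_src v; have [um _] := andP s; split.
  have [p [pp lp cp]] := tree_path_walk (src_tree_path s).
  by exists (nearest v), p.
move=> x p [xm pp lp]; have [t le] := walk_tree_path solS.1 pp lp.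
by apply: leq_trans le; apply: key_dist; apply/nearest_min/tree_path_src.
Qed.

Lemma nearest_bounded :
  bounded_max_retrieval G Rb S -> forall v, R (nearest v) v <= Rb.
Proof.
move=> [k kP kb] v; apply: leq_trans kb; apply: leq_trans (leq_bigmax v).
have [[x [p [rp <-]]] _] := kP v.
by have [_ ] := nearest_retrieval v; apply.
Qed.

Lemma bounded_of_paths :
  (forall v, exists x p, retrieval_path S v x p /\ path_retrieval G x p <= Rb) ->
  bounded_max_retrieval G Rb S.
Proof.
move=> bp; exists (fun v => R (nearest v) v); first exact: nearest_retrieval.
apply/bigmax_leqP => v _; have [x [p [rp]]] := bp v; apply: leq_trans.
by have [_ ] := nearest_retrieval v; apply.
Qed.

Lemma nearest_cost : \sum_v entry_cost v (nearest v) <= storage_cost G S.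
Proof.
rewrite /storage_cost (bigID (fun v => nearest v == v)) /=; apply: leq_add.
  rewrite (eq_bigr (fun v => vertex_storage G v)); last first.
    by move=> v E; rewrite /entry_cost E.
  rewrite [leqRHS]big_mkcond [leqLHS]big_mkcond; apply: leq_sum => v _.
  by case: eqP => // E; have /andP[] := nearest_src v; rewrite E => ->.
rewrite (eq_bigr (fun v => edge_storage G (nxt v (nearest v), v))); last first.
  by move=> v ne; rewrite /entry_cost (negbTE ne).
rewrite -(big_imset (h := fun v => (nxt v (nearest v), v)) (edge_storage G)
  (A := [pred v | nearest v != v])) /=; last by move=> x y _ _ [].
rewrite [leqRHS]big_mkcond [leqLHS]big_mkcond; apply: leq_sum => d _.
by case: imsetP => // -[v ne ->]; have [-> _] := nearest_step ne.
Qed.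

End Nearest.

(** * From a consistent assignment to a solution *)

Section FromAssignment.

Variable a : V -> V.
Hypotheses (a_cons : consistent a) (a_bound : forall v, R (a v) v <= Rb).

(** Consistency gives the predecessor of [v] the same source, so an induction on the measure [H]
    follows the path back until it reaches the source itself. *)
Lemma assignment_tree_path v : a (a v) = a v /\
  tree_path (assignment_solution a) (a v) v.
Proof.
have [k] := ubnP (H (a v) v); elim: k v => // k IH v lk.
have [E|ne] := eqVneq (a v) v; first by rewrite !E; split=> //; constructor.
have [] := IH (nxt v (a v)).
  by rewrite (a_cons ne); have := nav_HS nav ne; lia.
rewrite (a_cons ne) => E t; split=> //; constructor=> //.
by apply/imsetP; exists v; rewrite ?inE.
Qed.

Lemma assignment_retrieval_path v :
  exists x p, retrieval_path (assignment_solution a) v x p /\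
    path_retrieval G x p <= Rb.
Proof.
have [E t] := assignment_tree_path v.
have [p [pp lp cp]] := tree_path_walk t.
by exists (a v), p; split; [split=> //; rewrite inE E | rewrite cp].
Qed.

Lemma assignment_is_solution : is_solution G (assignment_solution a).
Proof.
split; first by move=> d /imsetP[v]; rewrite inE => ne -> /=; apply: nav_edge nav _ _ _.
by move=> v; have [x [p [rp _]]] := assignment_retrieval_path v; exists x, p.
Qed.

Lemma assignment_bounded : bounded_max_retrieval G Rb (assignment_solution a).
Proof.
exact: bounded_of_paths assignment_is_solution assignment_retrieval_path.
Qed.

End FromAssignment.

Lemma assignment_cost a :
  storage_cost G (assignment_solution a) = \sum_v entry_cost v (a v).
Proof.
rewrite /storage_cost [RHS](bigID (fun v => a v == v)) /=; congr (_ + _).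
  by apply: eq_big => [v|v]; rewrite inE // /entry_cost => ->.
rewrite big_imset /=; last by move=> x y _ _ [].
by apply: eq_big => [v|v]; rewrite inE // /entry_cost => /negbTE ->.
Qed.

(** * Penalized costs and consistency across single edges *)

Definition penalty : nat := (\sum_v vertex_storage G v).+1.

Definition entry (v u : V) : nat :=
  if Rb < R u v then penalty else entry_cost v u.

(** A single violation already costs [penalty], so cheapness certifies feasibility and a finite
    number can stand for infinity. *)
Lemma entry_low a : \sum_v entry v (a v) < penalty -> forall v, R (a v) v <= Rb.
Proof.
move=> lt v; rewrite leqNgt; apply/negP => gt; move: lt.
by rewrite (bigD1 v) //= {1}/entry gt; lia.
Qed.

Lemma entry_bounded a : (forall v, R (a v) v <= Rb) ->
  \sum_v entry v (a v) = \sum_v entry_cost v (a v).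
Proof.
by move=> b; apply: eq_bigr => v _; rewrite /entry ltnNge b.
Qed.

Lemma entry_id : \sum_v entry v v < penalty.
Proof.
rewrite ltnS; apply: leq_sum => v _.
by rewrite /entry (nav_R0 nav) /entry_cost eqxx.
Qed.

(** Consistency seen from one edge: the sources [x] of [z] and [y] of [v] may differ only if neither
    retrieval path crosses the edge. *)
Definition compatible (z v x y : V) : bool :=
  (x == y) || (nxt z x != v) && (nxt v y != z).

Lemma edge_neq z v : edge G z v -> z != v.
Proof.
by move=> ezv; apply/eqP => E; have := nav_turn nav z ezv; rewrite E; case: eqP.
Qed.

Lemma consistent_compatible a z v :
  consistent a -> edge G z v -> compatible z v (a z) (a v).
Proof.
move=> c ezv; rewrite /compatible; case: eqVneq => //= ne.
have nzv := edge_neq ezv.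
apply/andP; split; apply/eqP => E.
  have az : a z != z.
    by apply: contra_neq nzv => Ez; rewrite -E Ez (nav_self nav).
  by have := c z az; rewrite E => Ev; rewrite Ev eqxx in ne.
have av : a v != v.
  by apply: contra_neq nzv => Ev; rewrite -E Ev (nav_self nav).
by have := c v av; rewrite E => Ez; rewrite Ez eqxx in ne.
Qed.

Lemma compatible_sym z v x y : compatible z v x y = compatible v z y x.
Proof. by rewrite /compatible eq_sym andbC. Qed.

(** By [nav_turn] every edge joins some nonroot vertex to its parent, in one orientation or the
    other, and [compatible] is symmetric; checking parent edges therefore covers all edges. *)
Lemma compatible_consistent rho a :
  (forall w, w != rho -> compatible w (nxt w rho) (a w) (a (nxt w rho))) ->
  consistent a.
Proof.
move=> c v ne; set z := nxt v (a v).
have ezv : edge G z v by exact: nav_edge nav _ _ ne.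
have : compatible z v (a z) (a v).
  have nzv := edge_neq ezv; have := nav_turn nav rho ezv.
  have [Ez _|_ /esym/negbFE/eqP Ev] := eqVneq (nxt v rho) z.
    rewrite compatible_sym -Ez; apply: c; apply: contra_neq nzv => E.
    by rewrite -Ez E (nav_self nav).
  rewrite -Ev; apply: c; apply: contra_neq nzv => E.
  by rewrite -Ev E (nav_self nav).
rewrite /compatible => /orP[/eqP //|/andP[_]].
by rewrite /z eqxx.
Qed.

(** * Optimality of the tree recursion *)

Section DynamicProgram.

Variables (rho : V) (F : V -> V -> nat) (sel : V -> V -> V) (a : V -> V).
Hypothesis F_eq : forall v u,
  F v u = entry v u + \sum_(w | (w != rho) && (nxt w rho == v)) F w (sel w u).
Hypothesis sel_compatible : forall w u, w != rho ->
  compatible w (nxt w rho) (sel w u) u.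
Hypothesis sel_min : forall w u x, w != rho ->
  compatible w (nxt w rho) x u -> F w (sel w u) <= F w x.
Hypothesis a_root : forall u, F rho (a rho) <= F rho u.
Hypothesis a_step : forall w, w != rho -> a w = sel w (a (nxt w rho)).

(* Summing [F_eq] over the graph of [b], each nonroot [w] is charged at its parent. *)
Lemma sum_entry (b : V -> V) :
  \sum_v entry v (b v) + \sum_(w | w != rho) F w (sel w (b (nxt w rho))) =
  F rho (b rho) + \sum_(w | w != rho) F w (b w).
Proof.
rewrite -(bigD1 rho (P := predT) (F := fun v => F v (b v))) //=.
rewrite (eq_bigr _ (fun v _ => F_eq v (b v))) big_split /=; congr (_ + _).
rewrite (partition_big (fun w => nxt w rho) predT) //=.
by apply: eq_bigr => v _; apply: eq_bigr => w /andP[_ /eqP ->].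
Qed.

(** By [a_step] the sums over nonroot vertices on the two sides of [sum_entry] agree and cancel. *)
Lemma a_entry : \sum_v entry v (a v) = F rho (a rho).
Proof.
apply/eqP; rewrite -(eqn_add2r (\sum_(w | w != rho) F w (a w))) -sum_entry.
by rewrite eqn_add2l; apply/eqP/eq_bigr => w nw; rewrite -a_step.
Qed.

(** The same cancellation as an inequality: consistency makes [b w] an admissible competitor of
    [sel w (b (nxt w rho))] at each nonroot [w]. *)
Lemma consistent_entry b : consistent b -> F rho (a rho) <= \sum_v entry v (b v).
Proof.
move=> c; apply: leq_trans (a_root (b rho)) _.
rewrite -(leq_add2r (\sum_(w | w != rho) F w (b w))) -sum_entry leq_add2l.
apply: leq_sum => w nw; apply: sel_min => //; apply: consistent_compatible => //.
by rewrite (nav_sym nav); apply: nav_edge nav _ _ _; rewrite eq_sym.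
Qed.

Lemma dynamic_program_optimal : bmr_optimal G Rb (assignment_solution a).
Proof.
have c : consistent a.
  by apply: (compatible_consistent (rho := rho)) => w nw; rewrite {1}a_step ?sel_compatible.
(* Materializing every vertex, that is the assignment [id], is consistent and stays below [penalty];
   hence so does [a], which therefore respects the bound. *)
have low : \sum_v entry v (a v) < penalty.
  apply: leq_ltn_trans entry_id; rewrite a_entry.
  by apply: (consistent_entry (b := id)) => v; rewrite eqxx.
have b := entry_low low; split.
- exact: assignment_is_solution.
- exact: assignment_bounded.
move=> S' sol' bd'; rewrite assignment_cost -entry_bounded // a_entry.
apply: leq_trans (nearest_cost sol').
rewrite -entry_bounded; last exact: nearest_bounded.
exact/consistent_entry/nearest_consistent.
Qed.

End DynamicProgram.

End Assignments.

(** * Reasoning about programs and their running time *)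

Fixpoint written_vars (c : cmd) : seq nat :=
  match c with
  | Assign x _ => [:: x]
  | Seq c1 c2 | If _ c1 c2 => written_vars c1 ++ written_vars c2
  | While _ c1 => written_vars c1
  | _ => [::]
  end.

Fixpoint written_arrs (c : cmd) : seq nat :=
  match c with
  | Put a _ _ => [:: a]
  | Seq c1 c2 | If _ c1 c2 => written_arrs c1 ++ written_arrs c2
  | While _ c1 => written_arrs c1
  | _ => [::]
  end.

(** Footprints are closed lists computed from the program text, so the side conditions of
    non-interference are decided by reduction. *)
Record frame (X A : seq nat) (st st' : state) : Prop := Frame {
  frame_var : forall x, x \notin X -> vars st' x = vars st x;
  frame_arr : forall a, a \notin A -> arrs st' a = arrs st a
}.

Lemma exec_frame c st st' t :
  exec c st st' t -> frame (written_vars c) (written_arrs c) st st'.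
Proof.
elim=> {c st st' t} //=.
- by move=> st x e; split=> // y; rewrite inE /= => /negbTE ->.
- by move=> st a e1 e2; split=> // b; rewrite inE /= => /negbTE ->.
- move=> st s1 s2 c1 c2 t1 t2 _ [v1 a1] _ [v2 a2].
  split=> x; rewrite mem_cat negb_or => /andP[h1 h2]; first by rewrite v2 ?v1.
  by rewrite a2 ?a1.
- move=> st s1 e c1 c2 t _ _ [v1 a1].
  by split=> x; rewrite mem_cat negb_or => /andP[h1 h2]; rewrite ?v1 ?a1.
- move=> st s1 e c1 c2 t _ _ [v1 a1].
  by split=> x; rewrite mem_cat negb_or => /andP[h1 h2]; rewrite ?v1 ?a1.
- move=> st s1 s2 e c t1 t2 _ _ [v1 a1] _ [v2 a2].
  by split=> x h; rewrite ?v2 ?v1 ?a2 ?a1.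
Qed.

Fixpoint loop_free (c : cmd) : bool :=
  match c with
  | Seq c1 c2 | If _ c1 c2 => loop_free c1 && loop_free c2
  | While _ _ => false
  | _ => true
  end.

(** Lets reduction compute the final state of loop-free code. *)
Fixpoint run (c : cmd) (st : state) : state :=
  match c with
  | Skip => st
  | Assign x e => set_var st x (eval st e)
  | Put a e1 e2 => set_arr st a (eval st e1) (eval st e2)
  | Seq c1 c2 => run c2 (run c1 st)
  | If e c1 c2 => if eval st e != 0 then run c1 st else run c2 st
  | While _ _ => st
  end.

(* Running time up to the factor contributed by the iteration counts of loops. *)
Fixpoint weight (c : cmd) : nat :=
  match c with
  | Skip => 1
  | Assign _ e => (eval_time e).+1
  | Put _ e1 e2 => (eval_time e1 + eval_time e2).+1
  | Seq c1 c2 => (weight c1 + weight c2).+1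
  | If e c1 c2 => (eval_time e + (weight c1 + weight c2)).+1
  | While e c1 => (eval_time e).+1 + ((eval_time e).+1 + weight c1)
  end.

Lemma run_exec c st : loop_free c -> exists2 t, exec c st (run c st) t & t <= weight c.
Proof.
elim: c st => //=.
- by move=> st _; exists 1; first exact: ExecSkip.
- by move=> x e st _; exists (eval_time e).+1; first exact: ExecAssign.
- by move=> a e1 e2 st _; exists (eval_time e1 + eval_time e2).+1; first exact: ExecPut.
- move=> c1 IH1 c2 IH2 st /andP[l1 l2].
  have [t1 x1 b1] := IH1 st l1; have [t2 x2 b2] := IH2 (run c1 st) l2.
  by exists (t1 + t2).+1; [apply: ExecSeq x1 x2 | rewrite ltnS leq_add].
- move=> e c1 IH1 c2 IH2 st /andP[l1 l2].
  have [t1 x1 b1] := IH1 st l1; have [t2 x2 b2] := IH2 st l2.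
  case: (eqVneq (eval st e) 0) => [E|E] /=.
    by exists (eval_time e + t2).+1; [apply: ExecIfFalse | lia].
  by exists (eval_time e + t1).+1; [apply: ExecIfTrue | lia].
Qed.

(** Total correctness with a time bound split in two: [weight c] depends on the program alone, and
    [M] absorbs the iteration counts. The first factor becomes the constant of the final bound. *)
Definition wp (c : cmd) (M : nat) (Q : state -> Prop) (st : state) : Prop :=
  exists st' t, [/\ exec c st st' t, t <= weight c * M & Q st'].

Lemma wp_run c M (Q : state -> Prop) st :
  loop_free c -> 0 < M -> Q (run c st) -> wp c M Q st.
Proof.
move=> lf M0 q; have [t x b] := run_exec st lf; exists (run c st), t; split=> //.
by apply: leq_trans b _; rewrite leq_pmulr.
Qed.

Lemma wp_seq c1 c2 M (Q : state -> Prop) st :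
  0 < M -> wp c1 M (wp c2 M Q) st -> wp (Seq c1 c2) M Q st.
Proof.
move=> M0 [s1 [t1 [x1 b1 [s2 [t2 [x2 b2 q]]]]]].
exists s2, (t1 + t2).+1; split=> //; first exact: ExecSeq x1 x2.
by rewrite /= mulSn mulnDl; lia.
Qed.

Lemma wp_frame c M (Q : state -> Prop) st :
  wp c M Q st ->
  wp c M (fun s => Q s /\ frame (written_vars c) (written_arrs c) st s) st.
Proof.
by move=> [s [t [x b q]]]; exists s, t; split=> //; split=> //; apply: exec_frame x.
Qed.

Lemma wp_weaken c M M' (Q Q' : state -> Prop) st :
  M <= M' -> (forall s, Q s -> Q' s) -> wp c M Q st -> wp c M' Q' st.
Proof.
move=> le imp [s [t [x b q]]]; exists s, t; split=> //; last exact: imp.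
by apply: leq_trans b _; rewrite leq_mul2l le orbT.
Qed.

Definition For (x b : nat) (c : cmd) : cmd :=
  Seq (Assign x (Const 0))
    (While (Lt (Var x) (Var b)) (Seq c (Assign x (Add (Var x) (Const 1))))).

Lemma frame_trans X A s1 s2 s3 : frame X A s1 s2 -> frame X A s2 s3 -> frame X A s1 s3.
Proof. by move=> [v1 a1] [v2 a2]; split=> x h; rewrite ?v2 ?v1 ?a2 ?a1. Qed.

Lemma frame_sub X X' A A' s1 s2 :
  {subset X <= X'} -> {subset A <= A'} -> frame X A s1 s2 -> frame X' A' s1 s2.
Proof.
by move=> sX sA [v a]; split=> x h; [apply: v | apply: a]; apply: contra h;
  [apply: sX | apply: sA].
Qed.

Lemma frame_set_var X A st x k : x \in X -> frame X A st (set_var st x k).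
Proof. by move=> xX; split=> // y /=; case: eqP => // ->; rewrite xX. Qed.

(** Nested loops multiply their factors through [N * M <= M']. The invariant must survive a change
    of [x], since the loop itself resets and increments the counter. The frame premise hands the
    body all facts about cells that the loop does not write. *)
Lemma wp_for (I : nat -> state -> Prop) x b c N M M' st :
  x \notin written_vars c -> b \notin x :: written_vars c ->
  vars st b = N -> 0 < M -> 0 < M' -> N * M <= M' ->
  (forall i s k, I i s -> I i (set_var s x k)) ->
  I 0 st ->
  (forall i s, i < N -> vars s x = i -> I i s ->
     frame (x :: written_vars c) (written_arrs c) st s -> wp c M (I i.+1) s) ->
  wp (For x b c) M' (I N) st.
Proof.
move=> xc bc vb M0 M0' NM Istab I0 step.
have bx : b == x = false by move: bc; rewrite inE negb_or => /andP[/negbTE].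
(* Induction on the number [d] of iterations left. Besides the body, an iteration pays 4 for the
   test and 5 for the increment and sequencing; the last 4 is the failing test. *)
have loop : forall d i s, i + d = N -> vars s x = i -> I i s ->
    frame (x :: written_vars c) (written_arrs c) st s ->
    exists s' t, [/\ exec (While (Lt (Var x) (Var b))
        (Seq c (Assign x (Add (Var x) (Const 1))))) s s' t,
      t <= d * (4 + (weight c * M + 5)) + 4 & I N s'].
  elim=> [|d IH] i s E xi Ii fr.
    exists s, 4; split; last by rewrite -E addn0.
      by apply: ExecWhileFalse; rewrite /= (frame_var fr bc) vb xi -E addn0 ltnn.
    by rewrite mul0n.
  have iN : i < N by lia.
  have [s1 [t1 [x1 b1 I1]]] := step _ _ iN xi Ii fr.
  have fr1 : frame (x :: written_vars c) (written_arrs c) st s1.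
    apply: frame_trans fr _; apply: frame_sub (exec_frame x1) => // y.
    by rewrite inE orbC => ->.
  have s1x : vars s1 x = i by rewrite (frame_var (exec_frame x1)).
  have [||||s2 [t2 [x2 b2 I2]]] := IH i.+1 (set_var s1 x i.+1).
  - by rewrite -E; lia.
  - by rewrite /= eqxx.
  - exact: Istab.
  - by apply: frame_trans fr1 _; apply: frame_set_var; rewrite inE eqxx.
  exists s2, (3 + (t1 + 4).+1 + t2).+1; split=> //; last by rewrite mulSn; lia.
  apply: ExecWhileTrue x2 => /=; first by rewrite xi (frame_var fr bc) vb iN.
  apply: ExecSeq x1 _.
  have -> : i.+1 = eval s1 (Add (Var x) (Const 1)) by rewrite /= s1x addn1.
  exact: ExecAssign.
have [||||s' [t [ex bt Is]]] := loop N 0 (set_var st x 0).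
- by rewrite add0n.
- by rewrite /= eqxx.
- exact: Istab.
- by apply: frame_set_var; rewrite inE eqxx.
exists s', (2 + t).+1; split=> //.
  by apply: ExecSeq ex; apply: (ExecAssign st x (Const 0)).
(* The overhead of 9 per iteration is paid by the constant part of the weight, because [N <= M']. *)
rewrite /=; apply: (@leq_trans (N * 9 + weight c * M' + 7)).
  have : N * (weight c * M) <= weight c * M' by rewrite mulnCA leq_mul2l NM orbT.
  by rewrite !mulnDr in bt *; lia.
have NM' : N <= M' by apply: leq_trans NM; rewrite leq_pmulr.
have : N * 9 <= 9 * M' by rewrite mulnC leq_mul2l NM'.
by rewrite !(mulSn, mulnDl); lia.
Qed.

(** * The program and its correctness *)

Local Notation vn := 0 (only parsing).
Local Notation vbound := 1 (only parsing).
Local Notation vm := 2 (only parsing).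
Local Notation vi := 3 (only parsing).
Local Notation vj := 4 (only parsing).
Local Notation vacc := 5 (only parsing).
Local Notation vx := 6 (only parsing).
Local Notation vp := 7 (only parsing).
Local Notation vbest := 8 (only parsing).
Local Notation vsel := 9 (only parsing).
Local Notation vlast := 10 (only parsing).
Local Notation vpen := 11 (only parsing).

Local Notation Avstorage := 0 (only parsing).
Local Notation Atail := 1 (only parsing).
Local Notation Ahead := 2 (only parsing).
Local Notation Aestorage := 3 (only parsing).
Local Notation Aeretrieval := 4 (only parsing).
Local Notation Amat := 5 (only parsing).
Local Notation Astored := 6 (only parsing).
Local Notation Arow := 7 (only parsing).
Local Notation Aedge := 8 (only parsing).
Local Notation Aorder := 9 (only parsing).
Local Notation Acand := 10 (only parsing).
Local Notation Aseen := 11 (only parsing).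
Local Notation Anext := 12 (only parsing).
Local Notation Adist := 13 (only parsing).
Local Notation Acost := 14 (only parsing).
Local Notation Asel := 15 (only parsing).
Local Notation Asource := 16 (only parsing).

(* Entry [(x, y)] of a matrix is stored at [x * n + y]. *)
Local Notation cell x y := (Add (Get Arow x) y) (only parsing).
(* Edge positions are shifted by one in [Aedge], where [0] means no edge. *)
Local Notation edge_id x y := (Defs.Sub (Get Aedge (cell x y)) (Const 1)) (only parsing).

(** The machine cannot multiply, so the row offsets [i * n] are tabulated by repeated addition. The
    same pass accumulates the penalty. *)
Definition init_rows : cmd :=
  For vi vn
    (Seq (Put Arow (Var vi) (Var vacc))
    (Seq (Assign vacc (Add (Var vacc) (Var vn)))
         (Assign vpen (Add (Var vpen) (Get Avstorage (Var vi)))))).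

Definition init_edges : cmd :=
  For vi vm
    (Put Aedge (cell (Get Atail (Var vi)) (Get Ahead (Var vi)))
               (Add (Var vi) (Const 1))).

(** [vx] is the vertex added last. Only edges leaving it can yield new candidates, so one row of
    [Aedge] per round suffices. [Acand] holds one plus a parent, with 0 for none. *)
Definition scan : cmd :=
  For vj vn
    (Seq (If (Get Aedge (cell (Var vx) (Var vj)))
             (Put Acand (Var vj) (Add (Var vx) (Const 1))) Skip)
         (If (Get Acand (Var vj))
             (If (Get Aseen (Var vj)) Skip (Assign vsel (Var vj))) Skip)).

(** The loop runs over all indices without testing membership in the tree. Entries of vertices not
    yet added are garbage and are overwritten when those vertices join. *)
Definition extend_maps : cmd :=
  For vj vn
    (Seq (Put Adist (cell (Var vj) (Var vx))
            (Add (Get Adist (cell (Var vj) (Var vp)))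
                 (Get Aeretrieval (edge_id (Var vp) (Var vx)))))
    (Seq (Put Adist (cell (Var vx) (Var vj))
            (Add (Get Aeretrieval (edge_id (Var vx) (Var vp)))
                 (Get Adist (cell (Var vp) (Var vj)))))
    (Seq (Put Anext (cell (Var vx) (Var vj)) (Var vp))
         (If (Eq (Var vj) (Var vp))
             (Put Anext (cell (Var vj) (Var vx)) (Var vx))
             (Put Anext (cell (Var vj) (Var vx))
                (Get Anext (cell (Var vj) (Var vp)))))))).

(** Position 0 of [Aorder] belongs to the root, vertex 0, and is correct in zeroed memory; hence the
    shift by one. *)
Definition take_vertex : cmd :=
  Seq (Assign vx (Var vsel))
  (Seq (Assign vp (Defs.Sub (Get Acand (Var vx)) (Const 1)))
  (Seq (Put Aseen (Var vx) (Const 1))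
       (Put Aorder (Add (Var vi) (Const 1)) (Var vx)))).

(** Repairs the diagonal cell, which [extend_maps] spoils at [j = x]. *)
Definition close_maps : cmd :=
  Seq (Put Adist (cell (Var vx) (Var vx)) (Const 0))
      (Put Anext (cell (Var vx) (Var vx)) (Var vx)).

Definition grow : cmd :=
  For vi vlast
    (Seq scan (Seq take_vertex (Seq extend_maps close_maps))).

(** Columns of [Acost] are sources; the relevant distance runs from the source [vj] to [vi], hence
    the transposed cell of [Adist]. *)
Definition init_costs : cmd :=
  For vi vn (For vj vn
    (If (Lt (Var vbound) (Get Adist (cell (Var vj) (Var vi))))
        (Put Acost (cell (Var vi) (Var vj)) (Var vpen))
    (If (Eq (Var vj) (Var vi))
        (Put Acost (cell (Var vi) (Var vj)) (Get Avstorage (Var vi)))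
        (Put Acost (cell (Var vi) (Var vj))
           (Get Aestorage
              (edge_id (Get Anext (cell (Var vi) (Var vj))) (Var vi))))))).

(** [Aorder] is read backwards, so the children of [vx] have been charged to it already. The hop
    towards vertex 0 is the parent, and [vx] itself is a first source inside its own subtree. *)
Definition pick_child : cmd :=
  Seq (Assign vx (Get Aorder (Defs.Sub (Var vlast) (Var vi))))
  (Seq (Assign vp (Get Anext (cell (Var vx) (Const 0))))
       (Assign vbest (Var vx))).

(** A source lies in the subtree of [vx] exactly when the hop from [vx] towards it is not the
    parent. *)
Definition best_inside : cmd :=
  For vj vn
    (If (Eq (Get Anext (cell (Var vx) (Var vj))) (Var vp)) Skip
    (If (Lt (Get Acost (cell (Var vx) (Var vj)))
            (Get Acost (cell (Var vx) (Var vbest))))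
        (Assign vbest (Var vj)) Skip)).

(** A parent retrieved from inside the subtree of [vx] is reached through [vx], which must share
    that source. If the source lies outside, [vx] may switch to the best one inside. *)
Definition charge_parent : cmd :=
  For vj vn
    (Seq (Assign vsel (Var vj))
    (Seq (If (Eq (Get Anext (cell (Var vx) (Var vj))) (Var vp))
             (If (Lt (Get Acost (cell (Var vx) (Var vbest)))
                     (Get Acost (cell (Var vx) (Var vj))))
                 (Assign vsel (Var vbest)) Skip) Skip)
    (Seq (Put Asel (cell (Var vx) (Var vj)) (Var vsel))
         (Put Acost (cell (Var vp) (Var vj))
            (Add (Get Acost (cell (Var vp) (Var vj)))
                 (Get Acost (cell (Var vx) (Var vsel)))))))).

Definition sweep : cmd :=
  For vi vlast (Seq pick_child (Seq best_inside charge_parent)).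

Definition best_root : cmd :=
  For vj vn
    (If (Lt (Get Acost (cell (Const 0) (Var vj)))
            (Get Acost (cell (Const 0) (Var vbest))))
        (Assign vbest (Var vj)) Skip).

(** Vertices are visited in order of insertion, so the source of the parent is settled before that
    of the child. *)
Definition trace : cmd :=
  For vi vlast
    (Seq (Assign vx (Get Aorder (Add (Var vi) (Const 1))))
         (Put Asource (Var vx)
            (Get Asel (cell (Var vx)
               (Get Asource (Get Anext (cell (Var vx) (Const 0)))))))).

Definition output : cmd :=
  For vi vn
    (If (Eq (Get Asource (Var vi)) (Var vi))
        (Put Amat (Var vi) (Const 1))
        (Put Astored
           (edge_id (Get Anext (cell (Var vi) (Get Asource (Var vi)))) (Var vi))
           (Const 1))).

Definition bmr_program : cmd :=
  Seq (Seq (Assign vlast (Defs.Sub (Var vn) (Const 1))) (Assign vpen (Const 1)))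
  (Seq init_rows
  (Seq init_edges
  (Seq (Put Aseen (Const 0) (Const 1))
  (Seq grow
  (Seq init_costs
  (Seq sweep
  (Seq (Assign vbest (Const 0))
  (Seq best_root
  (Seq (Put Asource (Const 0) (Var vbest))
  (Seq trace output)))))))))).

(** * Correctness of the initialization and growth phases *)

Section Correctness.

Variables (n : nat) (G : version_graph 'I_n) (Rb : nat) (es : seq ('I_n * 'I_n)).
Hypotheses (tree : bidirectional_tree G) (listing : edge_listing G es).

Local Notation V := 'I_n.

Lemma n_gt0 : 0 < n.
Proof. by case: tree => e0 [+ _ _ _ _] _; rewrite card_ord. Qed.

Lemma edge_sym : symmetric (edge G).
Proof. by case: tree => e0 [_ s _ _ _] E u v; rewrite !E. Qed.

Lemma edge_irr : irreflexive (edge G).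
Proof. by case: tree => e0 [_ _ s _ _] E u; rewrite !E. Qed.

Lemma edge_connected u v : connect (edge G) u v.
Proof.
by case: tree => e0 [_ _ _ s _] E; rewrite (eq_connect E).
Qed.

Lemma edge_acyclic (c : seq V) : 2 < size c -> ~ ucycle (edge G) c.
Proof.
case: tree => e0 [_ _ _ _ s] E c2; rewrite /ucycle (eq_cycle E); exact: s.
Qed.

Definition root : V := Ordinal n_gt0.

Definition mat (f : nat -> nat) (u v : V) : nat := f (u * n + v).

Lemma mat_eq (u v x y : V) : (u * n + v == x * n + y) = (u == x) && (v == y).
Proof.
apply/eqP/andP => [E|[/eqP -> /eqP ->] //]; split; apply/eqP/val_inj => /=.
  by have := congr1 (divn^~ n) E; rewrite !divnMDl ?n_gt0 // !divn_small // !addn0.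
by have := congr1 (modn^~ n) E; rewrite !modnMDl !modn_small.
Qed.

Record input (s : state) : Prop := Input {
  input_n : vars s vn = n;
  input_bound : vars s vbound = Rb;
  input_m : vars s vm = size es;
  input_arr : forall a, a < 5 -> arrs s a = arrs (input_state G Rb es) a
}.

Lemma input_frame X A s s' : frame X A s s' ->
  ~~ has (fun x => x < 3) X -> ~~ has (fun a => a < 5) A -> input s -> input s'.
Proof.
move=> [fv fa] /hasPn hX /hasPn hA [i1 i2 i3 i4].
have nX x : x < 3 -> x \notin X by apply: contraL => /hX.
have nA a : a < 5 -> a \notin A by apply: contraL => /hA.
by split=> [|||a lt]; rewrite ?fv ?fa ?nX ?nA // i4.
Qed.

Section InputArrays.

Variable s : state.
Hypothesis inp : input s.

Lemma input_vstorage (v : V) : arrs s Avstorage v = vertex_storage G v.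
Proof.
by rewrite (input_arr inp) //= (nth_map v) ?size_enum_ord // nth_ord_enum.
Qed.

Lemma input_estorage u v : edge G u v ->
  arrs s Aestorage (index (u, v) es) = edge_storage G (u, v).
Proof.
rewrite -listing.2 (input_arr inp) //= => uv.
by rewrite (nth_map (u, v)) ?index_mem // nth_index.
Qed.

Lemma input_eretrieval u v : edge G u v ->
  arrs s Aeretrieval (index (u, v) es) = edge_retrieval G (u, v).
Proof.
rewrite -listing.2 (input_arr inp) //= => uv.
by rewrite (nth_map (u, v)) ?index_mem // nth_index.
Qed.

Lemma input_tail d i : i < size es -> arrs s Atail i = (nth d es i).1.
Proof. by move=> lt; rewrite (input_arr inp) //= (nth_map d). Qed.

Lemma input_head d i : i < size es -> arrs s Ahead i = (nth d es i).2.
Proof. by move=> lt; rewrite (input_arr inp) //= (nth_map d). Qed.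

End InputArrays.

Definition rows_ok (f : nat -> nat) := forall i, i < n -> f i = i * n.

Definition edges_ok (f : nat -> nat) := forall u v : V,
  mat f u v = if edge G u v then (index (u, v) es).+1 else 0.

Lemma init_rowsP s :
  input s -> vars s vacc = 0 -> vars s vpen = 1 ->
  wp init_rows n (fun s' => rows_ok (arrs s' Arow) /\ vars s' vpen = penalty G) s.
Proof.
move=> inp acc0 pen1.
pose I i s' := [/\ forall j, j < i -> arrs s' Arow j = j * n, vars s' vacc = i * n
  & vars s' vpen = (\sum_(j < n | j < i) vertex_storage G j).+1].
apply: (@wp_weaken _ n n (I n)) => //.
  move=> s' [rows _ pen]; split=> //; rewrite pen /penalty.
  by congr _.+1; apply: eq_bigl => j; rewrite ltn_ord.
apply: (@wp_for _ _ _ _ n 1) => //; rewrite ?(input_n inp) ?n_gt0 ?muln1 //.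
  by rewrite /I acc0 pen1; split=> //; rewrite big_pred0.
move=> i s' lt xi [rows acc pen] fr.
have inp' := input_frame fr isT isT inp.
apply: wp_run => //=; rewrite /I /= xi; split.
- move=> j; rewrite ltnS leq_eqVlt; case: eqP => [->|ne] //=.
  exact: rows.
- by rewrite acc (input_n inp') mulSn addnC.
rewrite pen [in RHS](bigD1 (Ordinal lt)) //= (input_vstorage inp' (Ordinal lt)).
rewrite addSn addnC; congr (_ + _).+1; apply: eq_bigl => j.
by rewrite -val_eqE /=; lia.
Qed.

Lemma init_edgesP s :
  input s -> rows_ok (arrs s Arow) -> (forall i, arrs s Aedge i = 0) ->
  wp init_edges (n * n) (fun s' => edges_ok (arrs s' Aedge)) s.
Proof.
move=> inp rows e0.
have nn : 0 < n * n by rewrite muln_gt0 n_gt0.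
pose I i s' := forall u v : V, mat (arrs s' Aedge) u v =
  if index (u, v) es < minn i (size es) then (index (u, v) es).+1 else 0.
apply: (@wp_weaken _ (n * n) (n * n) (I (size es))) => //.
  by move=> s' h u v; rewrite h minnn index_mem listing.2.
(* Distinctness of the listed pairs alone gives a bound that fits the quadratic budget. *)
have sz : size es <= n * n.
  by rewrite -(card_uniqP listing.1) -[n in n * n]card_ord -card_prod max_card.
apply: (@wp_for _ _ _ _ (size es) 1) => //; rewrite ?(input_m inp) ?muln1 //.
  by move=> u v; rewrite /mat e0 min0n.
move=> i s' lt xi h fr; have inp' := input_frame fr isT isT inp.
apply: wp_run => // u v; rewrite /mat /= xi.
rewrite (input_tail inp' (u, v) lt) (input_head inp' (u, v) lt).
rewrite (frame_arr fr) // rows // mat_eq.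
have := h u v; rewrite /mat => ->; rewrite (minn_idPl lt) (minn_idPl (ltnW lt)) ltnS.
set e := nth _ _ _.
have -> : (u == e.1) && (v == e.2) = (index (u, v) es == i).
  rewrite -xpair_eqE -surjective_pairing; apply/eqP/eqP => [->|E].
    by rewrite index_uniq // listing.1.
  by rewrite /e -E nth_index // -index_mem E.
case: eqP => [->|ne] /=; first by rewrite addn1 leqnn.
by rewrite [in RHS]leq_eqVlt (introF eqP ne).
Qed.

Local Notation ret := (edge_retrieval G).

Lemma edge_lookup f u v : edges_ok f -> edge G u v ->
  f (u * n + v) - 1 = index (u, v) es.
Proof. by move=> /(_ u v); rewrite /mat => -> ->; rewrite subn1. Qed.

Definition order_ok h (f : nat -> nat) :=
  forall v : V, v \in dom root h -> f (rank h v) = v.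

Definition seen_ok h (f : nat -> nat) :=
  forall v : V, (f v != 0) = (v \in dom root h).

(** Restricted to pairs inside the current tree, because [extend_maps] leaves arbitrary values
    elsewhere. *)
Definition maps_ok h (N D : nat -> nat) := forall u v : V,
  u \in dom root h -> v \in dom root h ->
  mat N v u = nx root h v u /\ mat D u v = dist ret h u v.

Definition cand_sound h (f : nat -> nat) := forall v : V, f v != 0 ->
  exists q : V, [/\ q \in dom root h, edge G q v & f v = q.+1].

(** Otherwise the current tree would be closed under edges and, by connectedness, contain all [n]
    vertices. *)
Lemma frontier h : growth (edge G) root h -> size h < n.-1 ->
  exists q v, [/\ q \in dom root h, v \notin dom root h & edge G q v].
Proof.
move=> g lt.
case: (boolP [exists q, exists v,
    [&& q \in dom root h, v \notin dom root h & edge G q v]]).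
  by move=> /existsP[q /existsP[v /and3P[]]]; exists q, v.
move=> /existsPn no; exfalso.
have cl : closed (edge G) (mem (dom root h)).
  apply: (intro_closed (sym_connect_sym edge_sym)) => q v eqv qd.
  by have /existsPn/(_ v) := no q; rewrite eqv andbT negb_and negbK qd.
have all_dom v : v \in dom root h.
  by have <- := closed_connect cl (edge_connected root v); apply: root_dom.
have : #|V| <= size (dom root h).
  apply: leq_trans (card_size _).
  by apply/subset_leq_card/subsetP => v _; apply: all_dom.
by rewrite card_ord size_dom leqNgt -ltn_predRL lt.
Qed.

Lemma scanP s h (x : V) :
  input s -> rows_ok (arrs s Arow) -> edges_ok (arrs s Aedge) ->
  growth (edge G) root h -> size h < n.-1 -> x \in dom root h ->
  seen_ok h (arrs s Aseen) -> vars s vx = x ->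
  cand_sound h (arrs s Acand) ->
  (forall q v : V, q \in dom root h -> q != x -> edge G q v ->
     arrs s Acand v != 0) ->
  wp scan n (fun s' => exists y : V,
    [/\ vars s' vsel = y, y \notin dom root h, cand_sound h (arrs s' Acand),
        arrs s' Acand y != 0
      & forall q v : V, q \in dom root h -> edge G q v ->
          arrs s' Acand v != 0]) s.
Proof.
move=> inp rows edges g lth xd seen vxs sound compl.
(* Candidates are complete for edges from older vertices and for edges from [x] to indices below
   [i]. Either an unseen candidate has been selected or there is none below [i]; at the end
   [frontier] refutes the second case. *)
pose I i s' := [/\ cand_sound h (arrs s' Acand),
  forall q v : V, q \in dom root h -> edge G q v -> (q != x) || (v < i) ->
     arrs s' Acand v != 0
  & (exists y : V, [/\ vars s' vsel = y, y \notin dom root h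
       & arrs s' Acand y != 0]) \/
    (forall v : V, v < i -> v \notin dom root h -> arrs s' Acand v = 0)].
apply: (@wp_weaken _ n n (I n)) => //.
  move=> s' [snd cmp yP].
  have cmp' q v : q \in dom root h -> edge G q v -> arrs s' Acand v != 0.
    by move=> qd eqv; apply: cmp qd eqv _; rewrite ltn_ord orbT.
  case: yP => [[y [yE yd y0]]|no]; first by exists y.
  have [q [v [qd vd eqv]]] := frontier g lth.
  by have := cmp' _ _ qd eqv; rewrite no ?eqxx.
apply: (@wp_for _ _ _ _ n 1) => //; rewrite ?(input_n inp) ?n_gt0 ?muln1 //.
  split=> // [q v qd eqv|]; last by right.
  by rewrite orbF => nq; apply: compl eqv.
move=> i s' lt xi [snd cmp yP] fr; pose j := Ordinal lt.
have vx' : vars s' vx = x by rewrite (frame_var fr).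
have row' : arrs s' Arow x = x * n by rewrite (frame_arr fr) // rows.
have E' : arrs s' Aedge (x * n + i) = mat (arrs s' Aedge) x j by [].
have seen' : arrs s' Aseen = arrs s Aseen by rewrite (frame_arr fr).
apply: wp_seq => //; apply: wp_run => //.
set s1 := run _ _.
have [s1c s1v s1s s1i] : [/\ arrs s1 Acand =1 fun k =>
      if edge G x j && (k == i) then x.+1 else arrs s' Acand k,
    vars s1 vsel = vars s' vsel, arrs s1 Aseen = arrs s' Aseen & vars s1 vj = i].
  rewrite /s1 /= xi vx' row' E' [arrs s' Aedge](frame_arr fr) // edges.
  by case: (edge G x j) => //=; split=> // k; rewrite ?addn1.
clearbody s1; have {}snd : cand_sound h (arrs s1 Acand).
  move=> v; rewrite s1c; case: ifP => [/andP[exj /eqP vi] _|_]; last exact: snd.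
  by exists x; split=> //; rewrite (_ : v = j) //; apply: val_inj.
have mono v : arrs s' Acand v != 0 -> arrs s1 Acand v != 0.
  by rewrite s1c; case: ifP.
have {}cmp q v : q \in dom root h -> edge G q v -> (q != x) || (v < i.+1) ->
    arrs s1 Acand v != 0.
  move=> qd eqv; rewrite ltnS leq_eqVlt orbCA => /orP[/eqP vi|h'].
    have [qx|nq] := eqVneq q x; last by apply/mono/(cmp q) => //; rewrite nq.
    by rewrite s1c -vi eqxx (_ : j = v) ?qx ?eqv -?qx ?eqv //; apply: val_inj.
  by apply/mono/(cmp q).
apply: wp_run => //=; rewrite s1i.
have [c0|cn0] /= := eqVneq (arrs s1 Acand i) 0.
  split=> //; case: yP => [[y [yE yd y0]]|no].
    by left; exists y; rewrite s1v; split=> //; apply: mono.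
  right=> v; rewrite ltnS leq_eqVlt => /orP[/eqP -> //|ltv] vd.
  by rewrite s1c (ltn_eqF ltv) andbF no.
have := seen j; rewrite s1s [arrs s' Aseen](frame_arr fr) // /= => ->.
case: (boolP (j \in dom root h)) => jd /=; last first.
  by split=> //; left; exists j.
split=> //; case: yP => [[y [yE yd y0]]|no].
  by left; exists y; rewrite s1v; split=> //; apply: mono.
right=> v; rewrite ltnS leq_eqVlt => /orP[/eqP vi|ltv] vd.
  by rewrite (_ : v = j) ?jd // in vd; apply: val_inj.
by rewrite s1c (ltn_eqF ltv) andbF no.
Qed.

Lemma mat_put (f g : nat -> nat) (x y : V) k :
  (forall i, g i = if i == x * n + y then k else f i) ->
  forall u v, mat g u v = if (u == x) && (v == y) then k else mat f u v.
Proof. by move=> E u v; rewrite /mat E mat_eq. Qed.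

Lemma extend_mapsP s h (x p : V) :
  input s -> rows_ok (arrs s Arow) -> edges_ok (arrs s Aedge) ->
  x \notin dom root h -> p \in dom root h -> edge G p x ->
  maps_ok h (arrs s Anext) (arrs s Adist) ->
  vars s vx = x -> vars s vp = p ->
  wp (Seq extend_maps close_maps) n
    (fun s' => maps_ok ((x, p) :: h) (arrs s' Anext) (arrs s' Adist)) s.
Proof.
move=> inp rows edges xd pd epx maps vxs vps.
have exp : edge G x p by rewrite edge_sym.
have px : p == x = false := notin_neq xd pd.
pose I i s' := maps_ok h (arrs s' Anext) (arrs s' Adist) /\
  forall y : V, y < i -> y \in dom root h ->
  [/\ mat (arrs s' Adist) y x = dist ret h y p + ret (p, x),
      mat (arrs s' Adist) x y = ret (x, p) + dist ret h p y,
      mat (arrs s' Anext) x y = p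
    & mat (arrs s' Anext) y x = if y == p then x else nx root h y p].
apply: wp_seq; rewrite ?n_gt0 //.
apply: (@wp_weaken _ n n (fun s' => I n s' /\
  frame (written_vars extend_maps) (written_arrs extend_maps) s s')) => //.
  move=> s' [[old new] fr]; apply: wp_run; rewrite ?n_gt0 //.
  have vx' : vars s' vx = x by rewrite (frame_var fr).
  have row' : arrs s' Arow x = x * n by rewrite (frame_arr fr) // rows.
  set s2 := run _ _.
  have EN : forall i, arrs s2 Anext i =
      if i == x * n + x then (x : nat) else arrs s' Anext i.
    by move=> i; rewrite /s2 /= vx' row'.
  have ED : forall i, arrs s2 Adist i =
      if i == x * n + x then 0 else arrs s' Adist i.
    by move=> i; rewrite /s2 /= vx' row'.
  move=> u v; rewrite !inE (mat_put EN) (mat_put ED) /=.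
  case: (eqVneq u x) => [->|nu] /=; case: (eqVneq v x) => [->|nv] //= ud vd.
  - by have [_ -> _ ->] := new v (ltn_ord v) vd; case: ifP.
  - by have [-> _ -> _] := new u (ltn_ord u) ud.
  - exact: old.
apply: wp_frame.
apply: (@wp_for _ _ _ _ n 1) => //; rewrite ?(input_n inp) ?n_gt0 ?muln1 //.
move=> i s' lt xi [old new] fr; pose j := Ordinal lt.
have inp' := input_frame fr isT isT inp.
have vx' : vars s' vx = x by rewrite (frame_var fr).
have vp' : vars s' vp = p by rewrite (frame_var fr).
have row' (v : V) : arrs s' Arow v = v * n by rewrite (frame_arr fr) // rows.
have edges' : edges_ok (arrs s' Aedge) by rewrite (frame_arr fr).
have xi' : vars s' vj = j by [].
apply: wp_run => //; set s2 := run _ _.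
(* The second write reads [Adist] after the first one; the inner test records an overlap, which
   would require [p = j = x]. *)
have ED : forall k, arrs s2 Adist k =
    if k == x * n + j then
      ret (x, p) + (if p * n + j == j * n + x then mat (arrs s' Adist) j p + ret (p, x)
                    else mat (arrs s' Adist) p j)
    else if k == j * n + x then mat (arrs s' Adist) j p + ret (p, x)
    else arrs s' Adist k.
  move=> k; rewrite /s2 /= xi' vx' vp' !row' !edge_lookup // !input_eretrieval //.
  by case: ifP; rewrite /= ?xi' ?vx' ?vp' ?row'.
have EN : forall k, arrs s2 Anext k =
    if k == j * n + x then
      if j == p then (x : nat)
      else if j * n + p == x * n + j then (p : nat) else mat (arrs s' Anext) j p
    else if k == x * n + j then (p : nat) else arrs s' Anext k.
  move=> k; rewrite /s2 /= xi' vx' vp' !row'.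
  by rewrite -val_eqE /=; case: (i == p :> nat); rewrite /= ?xi' ?vx' ?vp' ?row'.
clearbody s2.
have MD u v : mat (arrs s2 Adist) u v =
    if (u == x) && (v == j) then
      ret (x, p) + (if (p == j) && (j == x) then mat (arrs s' Adist) j p + ret (p, x)
                    else mat (arrs s' Adist) p j)
    else if (u == j) && (v == x) then mat (arrs s' Adist) j p + ret (p, x)
    else mat (arrs s' Adist) u v by rewrite /mat ED !mat_eq.
have MN u v : mat (arrs s2 Anext) u v =
    if (u == j) && (v == x) then
      if j == p then (x : nat)
      else if (j == x) && (p == j) then (p : nat) else mat (arrs s' Anext) j p
    else if (u == x) && (v == j) then (p : nat) else mat (arrs s' Anext) u v.
  by rewrite /mat EN !mat_eq.
split.
  move=> u v ud vd; rewrite MD MN !(notin_neq xd ud) !(notin_neq xd vd) !andbF /=.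
  exact: old.
move=> y; rewrite ltnS leq_eqVlt => /orP[/eqP yi|lty] yd; rewrite !MD !MN.
  have <- : y = j by apply: val_inj.
  have yx := notin_neq xd yd; have xy : x == y = false by rewrite eq_sym.
  rewrite !eqxx yx xy /= !andbF /=.
  by have [-> ->] := old _ _ pd yd; have [_ ->] := old _ _ yd pd; split=> //; case: ifP.
have yx := notin_neq xd yd.
have yj : y == j = false by rewrite -val_eqE /= ltn_eqF.
by rewrite yx yj !andbF /=; apply: new.
Qed.

Record grown (h : seq (V * V)) (s : state) : Prop := Grown {
  grown_growth : growth (edge G) root h;
  grown_order : order_ok h (arrs s Aorder);
  grown_maps : maps_ok h (arrs s Anext) (arrs s Adist)
}.

Lemma growP s :
  input s -> rows_ok (arrs s Arow) -> edges_ok (arrs s Aedge) ->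
  vars s vlast = n.-1 -> vars s vx = 0 ->
  (forall i, arrs s Aseen i = (i == 0)) ->
  (forall a i, a \in [:: Acand; Aorder; Anext; Adist] -> arrs s a i = 0) ->
  wp grow (n * n) (fun s' => exists h, size h = n.-1 /\ grown h s') s.
Proof.
move=> inp rows edges lasts vxs seen zero.
(* [x] is the newest vertex, initially the root; its outgoing edges are the only ones that may still
   be missing from [Acand]. *)
pose I k s' := exists h (x : V), [/\ size h = k, grown h s' & seen_ok h (arrs s' Aseen)] /\
  [/\ x \in dom root h, vars s' vx = x, cand_sound h (arrs s' Acand)
    & forall q v : V, q \in dom root h -> q != x -> edge G q v ->
        arrs s' Acand v != 0].
apply: (@wp_weaken _ (n * n) (n * n) (I n.-1)) => //.
  by move=> s' [h [x [[sz gr _] _]]]; exists h.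
apply: (@wp_for _ _ _ _ n.-1 n); rewrite ?muln_gt0 ?n_gt0 ?leq_mul2r ?leq_pred ?orbT //.
- by move=> i s' k [h [x [[sz [g o m] sn] r]]]; exists h, x.
- exists [::], root; split; last first.
    split=> //; first by move=> v; rewrite zero.
    by move=> q v; rewrite inE => ->.
  split=> //.
    split=> //= [v|u v]; rewrite !inE => /eqP ->; first by rewrite zero.
    by move=> /eqP ->; rewrite /mat !zero.
  by move=> v; rewrite seen inE -[v == root]val_eqE /=; case: (nat_of_ord v == 0).
move=> i s' lt xi [h [x [[sz gr sn] [xd vx' snd cmp]]]] fr.
have inp' := input_frame fr isT isT inp.
have rows' : rows_ok (arrs s' Arow) by rewrite (frame_arr fr).
have edges' : edges_ok (arrs s' Aedge) by rewrite (frame_arr fr).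
case: gr => g ord maps.
apply: wp_seq; rewrite ?n_gt0 //.
apply: wp_weaken (wp_frame (scanP inp' rows' edges' g _ xd sn vx' snd cmp)) => //;
  last by rewrite sz.
move=> s1 [[y [ysel yd snd1 cy cmp1]] fr1].
have [p [pd epy cyE]] := snd1 y cy.
apply: wp_seq; rewrite ?n_gt0 //; apply: wp_run; rewrite ?n_gt0 //.
set s2 := run _ _.
have xi1 : vars s1 vi = i by rewrite (frame_var fr1).
have [vx2 vp2] : vars s2 vx = y /\ vars s2 vp = p.
  by rewrite /s2 /= ysel cyE subn1.
have seen2 k : arrs s2 Aseen k = if k == y then 1 else arrs s' Aseen k.
  by rewrite /s2 /= ysel (frame_arr fr1).
have ord2 k : arrs s2 Aorder k = if k == i.+1 then (y : nat) else arrs s' Aorder k.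
  by rewrite /s2 /= ysel xi1 addn1 (frame_arr fr1).
have cand2 : arrs s2 Acand = arrs s1 Acand by [].
have fr2 : frame [:: vj; vsel; vx; vp] [:: Acand; Aseen; Aorder] s' s2.
  apply: (@frame_trans _ _ _ s1); first by apply: frame_sub fr1; apply/allP.
  by split=> k; rewrite !inE !negb_or /s2 /=;
    do !case: eqP => //= _.
clearbody s2.
have inp2 := input_frame fr2 isT isT inp'.
have rows2 : rows_ok (arrs s2 Arow) by rewrite (frame_arr fr2).
have edges2 : edges_ok (arrs s2 Aedge) by rewrite (frame_arr fr2).
have maps2 : maps_ok h (arrs s2 Anext) (arrs s2 Adist) by rewrite !(frame_arr fr2).
apply: wp_weaken (wp_frame
  (extend_mapsP inp2 rows2 edges2 yd pd epy maps2 vx2 vp2)) => //.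
move=> s3 [maps3 fr3]; exists ((y, p) :: h), y.
have g3 : growth (edge G) root ((y, p) :: h).
  split=> // q qd eqy.
  exact: (growth_only_edge edge_sym g edge_acyclic yd pd epy qd eqy).
split; split=> //=.
- by rewrite sz.
- split=> // v; rewrite (frame_arr fr3) // ord2 !inE /= sz.
  case: (eqVneq v y) => [->|ne] /= vd; first by rewrite eqxx.
  have := rank_size h v; rewrite sz => le.
  by rewrite (ltn_eqF (m := rank h v)) ?ltnS // ord.
- move=> v; rewrite (frame_arr fr3) // seen2 !inE -[v == y]val_eqE /=.
  by case: (nat_of_ord v == y) => //=; rewrite sn.
- exact: mem_head.
- by rewrite (frame_var fr3).
- move=> v; rewrite (frame_arr fr3) // cand2 => /snd1[q [qd eqv ->]].
  by exists q; rewrite inE qd orbT.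
- move=> q v; rewrite (frame_arr fr3) // cand2 inE => /orP[-> //|qd] _.
  exact: cmp1.
Qed.

(** * Evaluating the recursion on the completed tree *)

Section Grown.

Variable h : seq (V * V).
Hypotheses (g : growth (edge G) root h) (h_size : size h = n.-1).

Local Notation nxt := (nx root h).
Local Notation R := (dist ret h).

Lemma dom_full v : v \in dom root h.
Proof.
apply/negPn/negP => vd.
have /card_uniqP E : uniq (v :: dom root h) by rewrite /= vd (growth_uniq g).
have := max_card (mem (v :: dom root h)).
by rewrite E card_ord /= size_dom h_size prednK ?n_gt0 // ltnn.
Qed.

Lemma nav : navigation (edge G) ret nxt R (dist (fun _ => 1) h).
Proof. exact: growth_navigation edge_sym edge_irr g dom_full. Qed.

Lemma rank_lt v : rank h v < n.
Proof. by have := rank_size h v; rewrite h_size -ltnS prednK ?n_gt0. Qed.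

(** An injection of ['I_n] into itself is onto. This supplies the vertex treated in a given round of
    [sweep] and [trace]. *)
Lemma rank_onto i : i < n -> exists v, rank h v = i.
Proof.
move=> lt; pose f v := Ordinal (rank_lt v).
have f_inj : injective f.
  by move=> u v [E]; apply: (rank_inj g) E; apply: dom_full.
have /codomP[v E] := inj_card_onto f_inj (leqnn _) (Ordinal lt).
by exists v; have := congr1 val E.
Qed.

Lemma rank_gt0 v : (0 < rank h v) = (v != root).
Proof.
have [->|ne] := eqVneq v root; first by rewrite (rank_root g).
by apply: leq_ltn_trans (rank_nx g (dom_full v) ne).
Qed.

(** What the growth phase leaves behind and no later phase disturbs. *)
Record tables (s : state) : Prop := Tables {
  tables_input : input s;
  tables_rows : rows_ok (arrs s Arow);
  tables_edges : edges_ok (arrs s Aedge);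
  tables_order : forall v : V, arrs s Aorder (rank h v) = v;
  tables_next : forall u v : V, arrs s Anext (u * n + v) = nxt u v;
  tables_last : vars s vlast = n.-1
}.

Lemma tables_frame X A s s' : frame X A s s' ->
  ~~ has [in [:: vn; vbound; vm; vlast]] X ->
  ~~ has (fun a => a \in [:: Avstorage; Atail; Ahead; Aestorage; Aeretrieval;
                            Arow; Aedge; Aorder; Anext]) A ->
  tables s -> tables s'.
Proof.
move=> fr /hasPn hX /hasPn hA [inp rows edges ord nxts lst].
have fv x : x \in [:: vn; vbound; vm; vlast] -> vars s' x = vars s x.
  by move=> xin; apply: (frame_var fr); apply: contraL xin => /hX.
have fa a : a \in [:: Avstorage; Atail; Ahead; Aestorage; Aeretrieval;
    Arow; Aedge; Aorder; Anext] -> arrs s' a = arrs s a.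
  by move=> ain; apply: (frame_arr fr); apply: contraL ain => /hA.
case: inp => i1 i2 i3 i4; split; rewrite ?fv ?fa //; split; rewrite ?fv //.
by move=> a lt; rewrite fa ?i4 //; do 5?case: a lt => [|a] //.
Qed.

Local Notation entry := (entry G Rb nxt R).

Lemma init_costsP s :
  tables s -> vars s vpen = penalty G ->
  (forall u v : V, arrs s Adist (u * n + v) = R u v) ->
  wp init_costs (n * n) (fun s' => forall v u, mat (arrs s' Acost) v u = entry v u) s.
Proof.
move=> tab pen dst.
pose I i s' := forall v u : V, v < i -> mat (arrs s' Acost) v u = entry v u.
apply: (@wp_weaken _ (n * n) (n * n) (I n)) => //; first by move=> s' Is v u; apply: Is.
apply: (@wp_for _ _ _ _ n n); rewrite ?muln_gt0 ?n_gt0 ?(input_n (tables_input tab)) //.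
move=> i s' lt xi Is fr; pose v := Ordinal lt.
have tab' := tables_frame fr isT isT tab.
pose J j s'' := (forall v' u : V, v' < i -> mat (arrs s'' Acost) v' u = entry v' u) /\
  forall u : V, u < j -> mat (arrs s'' Acost) v u = entry v u.
apply: (@wp_weaken _ n n (J n)) => //.
  move=> s'' [old new] v' u; rewrite ltnS leq_eqVlt => /orP[/eqP E|]; last exact: old.
  by rewrite (_ : v' = v) ?new //; apply: val_inj.
apply: (@wp_for _ _ _ _ n 1) => //; rewrite ?muln1 ?n_gt0 ?(input_n (tables_input tab')) //.
move=> j s'' ltj xj [old new] fr'; pose u := Ordinal ltj.
have tab'' := tables_frame fr' isT isT tab'; have inp := tables_input tab''.
have xi' : vars s'' vi = v by rewrite (frame_var fr').
have xj' : vars s'' vj = u by [].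
have row (w : V) : arrs s'' Arow w = w * n by rewrite (tables_rows tab'').
have dst' : arrs s'' Adist (u * n + v) = R u v by rewrite (frame_arr fr') // (frame_arr fr) // dst.
have pen' : vars s'' vpen = penalty G by rewrite (frame_var fr') // (frame_var fr).
apply: wp_run => //; set s2 := run _ _.
have E : forall k, arrs s2 Acost k =
    if k == v * n + u then entry v u else arrs s'' Acost k.
  move=> k; rewrite /s2 /entry /entry_cost /= xi' xj' !row dst' (input_bound inp).
  case: (Rb < R u v) => /=; first by rewrite ?xi' ?xj' ?row pen'.
  rewrite -val_eqE /=.
  have [Euv|ne] := eqVneq (u : nat) v => /=; rewrite ?xi' ?xj' ?row.
    by rewrite (input_vstorage inp v).
  rewrite (tables_next tab'' v u) row.
  have euv : edge G (nxt v u) v by apply: (nav_edge nav).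
  by rewrite (edge_lookup (tables_edges tab'') euv) (input_estorage inp).
clearbody s2; have M := mat_put E; split.
  move=> v' u' ltv; rewrite M old // -val_eqE /=.
  by rewrite ltn_eqF.
move=> u'; rewrite ltnS leq_eqVlt M eqxx => /orP[/eqP E'|ltu].
  by rewrite (_ : u' = u) ?eqxx //; apply: val_inj.
by rewrite -val_eqE /= ltn_eqF //= new.
Qed.

Lemma best_insideP s (w : V) :
  tables s -> w != root ->
  vars s vx = w -> vars s vp = nxt w root -> vars s vbest = w ->
  wp best_inside n (fun s' => exists b : V,
    [/\ vars s' vbest = b, nxt w b != nxt w root
      & forall u, nxt w u != nxt w root ->
          mat (arrs s Acost) w b <= mat (arrs s Acost) w u]) s.
Proof.
move=> tab nw vxs vps vbs; pose F := mat (arrs s Acost).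
pose I i s' := exists b : V, [/\ vars s' vbest = b, nxt w b != nxt w root
  & forall u : V, u < i -> nxt w u != nxt w root -> F w b <= F w u].
apply: (@wp_weaken _ n n (I n)) => //.
  by move=> s' [b [b1 b2 b3]]; exists b; split=> // u; apply: b3.
apply: (@wp_for _ _ _ _ n 1) => //; rewrite ?muln1 ?n_gt0 ?(input_n (tables_input tab)) //.
  exists w; split=> //; rewrite (nav_self nav) eq_sym.
  by apply: (edge_neq nav); apply: (nav_edge nav); rewrite eq_sym.
move=> i s' lt xi [b [b1 b2 b3]] fr; pose u := Ordinal lt.
have tab' := tables_frame fr isT isT tab.
have row (v : V) : arrs s' Arow v = v * n by rewrite (tables_rows tab').
have xi' : vars s' vj = u by [].
have vx' : vars s' vx = w by rewrite (frame_var fr).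
have vp' : vars s' vp = nxt w root by rewrite (frame_var fr).
have cost' v : arrs s' Acost (w * n + v) = arrs s Acost (w * n + v).
  by rewrite (frame_arr fr).
have upd (b' : V) : nxt w b' != nxt w root -> F w b' <= F w b ->
    (nxt w u != nxt w root -> F w b' <= F w u) ->
    forall u' : V, u' < i.+1 -> nxt w u' != nxt w root -> F w b' <= F w u'.
  move=> nb le1 le2 u'; rewrite ltnS leq_eqVlt => /orP[/eqP E|ltu] nu.
    by have E' : u' = u by [apply: val_inj]; rewrite E' in nu *; apply: le2.
  exact: leq_trans le1 (b3 _ ltu nu).
apply: wp_run => //=; rewrite xi' vx' vp' b1 row (tables_next tab').
rewrite (inj_eq val_inj).
have [E|ne] /= := eqVneq (nxt w u) (nxt w root).
  by exists b; split=> //; apply: upd => //; rewrite E eqxx.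
rewrite ?xi' ?vx' ?b1 ?row !cost' -[arrs s Acost (w * n + u)]/(F w u).
rewrite -[arrs s Acost (w * n + b)]/(F w b).
have [ltF|geF] /= := ltnP (F w u) (F w b).
  by exists u; split=> //; apply: upd => //; apply: ltnW.
by exists b; split=> //; apply: upd.
Qed.

Lemma charge_parentP s (w b : V) :
  tables s -> w != root ->
  vars s vx = w -> vars s vp = nxt w root -> vars s vbest = b ->
  let F := mat (arrs s Acost) in
  let pick u := if (nxt w u == nxt w root) && (F w b < F w u) then b else u in
  wp charge_parent n (fun s' =>
    (forall x u, mat (arrs s' Asel) x u =
       if x == w then (pick u : nat) else mat (arrs s Asel) x u) /\
    (forall v u, mat (arrs s' Acost) v u =
       if v == nxt w root then F v u + F w (pick u) else F v u)) s.
Proof.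
move=> tab nw vxs vps vbs F pick; set v := nxt w root.
have vw : v == w = false.
  apply/negbTE/(edge_neq nav)/(nav_edge nav); by rewrite eq_sym.
pose I i s' :=
  (forall x u : V, mat (arrs s' Asel) x u =
     if (x == w) && (u < i) then (pick u : nat) else mat (arrs s Asel) x u) /\
  (forall x u : V, mat (arrs s' Acost) x u =
     if (x == v) && (u < i) then F x u + F w (pick u) else F x u).
apply: (@wp_weaken _ n n (I n)) => //.
  by move=> s' [sl cs]; split=> x u; rewrite ?sl ?cs ltn_ord andbT.
apply: (@wp_for _ _ _ _ n 1) => //; rewrite ?muln1 ?n_gt0 ?(input_n (tables_input tab)) //.
  by split=> x u; rewrite andbF.
move=> i s' lt xi [sl cs] fr; pose u := Ordinal lt.
have tab' := tables_frame fr isT isT tab.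
have row (x : V) : arrs s' Arow x = x * n by rewrite (tables_rows tab').
have xi' : vars s' vj = u by [].
have vx' : vars s' vx = w by rewrite (frame_var fr).
have vp' : vars s' vp = v by rewrite (frame_var fr).
have vb' : vars s' vbest = b by rewrite (frame_var fr).
have Fw x : arrs s' Acost (w * n + nat_of_ord x) = F w x.
  by have := cs w x; rewrite eq_sym vw.
have Fv : arrs s' Acost (v * n + u) = F v u.
  by have := cs v u; rewrite /= ltnn andbF.
apply: wp_run => //; set s2 := run _ _.
have [ES EC] : (forall k, arrs s2 Asel k =
      if k == w * n + u then (pick u : nat) else arrs s' Asel k) /\
    (forall k, arrs s2 Acost k =
      if k == v * n + u then F v u + F w (pick u) else arrs s' Acost k).
  rewrite /s2 /= xi' vx' vp' vb' !row (tables_next tab' w u) (Fw u) Fw.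
  rewrite (inj_eq val_inj) /pick -/v.
  case: (nxt w u == v) => /=; first case: (F w b < F w u) => /=.
  - by split=> k; rewrite ?xi' ?vx' ?vp' ?vb' ?row ?Fv ?Fw.
  - by split=> k; rewrite ?xi' ?vx' ?vp' ?vb' ?row ?Fv ?(Fw u).
  - by split=> k; rewrite ?xi' ?vx' ?vp' ?vb' ?row ?Fv ?(Fw u).
clearbody s2; have MS := mat_put ES; have MC := mat_put EC.
have lt_i (u' : V) : (u' < i.+1) = (u' == u) || (u' < i).
  by rewrite ltnS leq_eqVlt -val_eqE.
split=> x u'; rewrite ?MS ?MC ?sl ?cs lt_i.
  by case: (eqVneq u' u) => [->|ne]; case: (x == w); rewrite /= ?ltnn.
case: (eqVneq u' u) => [->|ne]; case: (eqVneq x v) => [->|nx] //=.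
Qed.

(** Cells hold plain numbers, and out-of-range values fall back to [root]; [swept_val] records that
    the entries of processed vertices are genuine vertices. *)
Definition to_vertex (k : nat) : V := insubd root k.

Lemma to_vertexK (v : V) : to_vertex v = v.
Proof. exact: valKd. Qed.

Definition choice (s : state) (w u : V) : V := to_vertex (mat (arrs s Asel) w u).

Definition sel_ok (F : V -> V -> nat) (sel : V -> V -> V) (w : V) :=
  forall u, compatible nxt w (nxt w root) (sel w u) u /\
    forall x, compatible nxt w (nxt w root) x u -> F w (sel w u) <= F w x.

(** The recursion with sums restricted to the set [D] of vertices already charged to their parents.
    Once [D] contains all nonroot vertices it is the full recursion. *)
Record swept (D : pred V) (s : state) : Prop := Swept {
  swept_cost : forall v u, mat (arrs s Acost) v u = entry v u +
    \sum_(w | D w && (nxt w root == v)) mat (arrs s Acost) w (choice s w u);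
  swept_sel : forall w, D w -> sel_ok (mat (arrs s Acost)) (choice s) w;
  swept_val : forall w u, D w -> mat (arrs s Asel) w u = choice s w u
}.

Lemma eq_swept (D D' : pred V) s : D =1 D' -> swept D s -> swept D' s.
Proof.
move=> E [c1 c2 c3]; split=> [v u|w|w u]; rewrite -?E; [|exact: c2|exact: c3].
by rewrite c1; congr (_ + _); apply: eq_bigl => w; rewrite E.
Qed.

Lemma sweepP s :
  tables s -> (forall v u, mat (arrs s Acost) v u = entry v u) ->
  wp sweep (n * n) (swept (predC1 root)) s.
Proof.
move=> tab cost0.
(* After [i] rounds exactly the [i] youngest vertices have been processed. *)
pose D i w := n.-1 - i < rank h w.
apply: (@wp_weaken _ (n * n) (n * n) (swept (D n.-1))) => //.
  by move=> s'; apply: eq_swept => w; rewrite /D subnn rank_gt0.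
apply: (@wp_for (fun i => swept (D i)) _ _ _ n.-1 n);
  rewrite ?muln_gt0 ?n_gt0 ?leq_mul2r ?leq_pred ?orbT ?(tables_last tab) //.
- by move=> i s' k [].
- have D0 w : D 0 w = false.
    by apply/negbTE; rewrite /D subn0 -leqNgt -h_size rank_size.
  split=> [v u|w|w u]; rewrite ?D0 // cost0 big_pred0 ?addn0 // => w.
  by rewrite D0.
move=> i s' lt xi [old1 old2 old3] fr.
have tab' := tables_frame fr isT isT tab.
have [w rw] : exists w, rank h w = n.-1 - i by apply: rank_onto; lia.
have nw : w != root by rewrite -rank_gt0 rw subn_gt0.
set v := nxt w root.
have vw : v != w by apply: (edge_neq nav); apply: (nav_edge nav); rewrite eq_sym.
have ewv : edge G w v by rewrite edge_sym; apply: (nav_edge nav); rewrite eq_sym.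
have rv : rank h v < rank h w := rank_nx g (dom_full w) nw.
have D_S x : D i.+1 x = (x == w) || D i x.
  rewrite /D -rw; have -> : (n.-1 - i.+1 < rank h x) = (rank h w <= rank h x).
    by rewrite rw; have := rw; lia.
  rewrite leq_eqVlt; congr (_ || _); apply/eqP/eqP => [E|-> //].
  by apply: (rank_inj g) (esym E); apply: dom_full.
have Dw : D i w = false by rewrite /D rw ltnn.
have Dv : D i.+1 v = false.
  by rewrite D_S (negbTE vw) /D -rw; apply/negbTE; rewrite -leqNgt ltnW.
apply: wp_seq; rewrite ?n_gt0 //; apply: wp_run; rewrite ?n_gt0 //; set s1 := run _ _.
have [vx1 vp1 vb1] : [/\ vars s1 vx = w, vars s1 vp = v & vars s1 vbest = w].
  rewrite /s1 /= (tables_last tab') xi -rw (tables_order tab') (tables_rows tab') //.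
  by split=> //; exact: (tables_next tab' w root).
have [cost1 sel1] : arrs s1 Acost = arrs s' Acost /\ arrs s1 Asel = arrs s' Asel by [].
have fr1 : frame [:: vx; vp; vbest] [::] s' s1.
  by split=> // k; rewrite !inE !negb_or /s1 /=; do !case: eqP => //= _.
clearbody s1; have tab1 := tables_frame fr1 isT isT tab'.
apply: wp_seq; rewrite ?n_gt0 //.
apply: wp_weaken (wp_frame (best_insideP tab1 nw vx1 vp1 vb1)) => //.
move=> s2 [[b [vb2 b_in b_min]] fr2].
have tab2 := tables_frame fr2 isT isT tab1.
have cost2 : arrs s2 Acost = arrs s' Acost by rewrite (frame_arr fr2).
have sel2 : arrs s2 Asel = arrs s' Asel by rewrite (frame_arr fr2).
have vx2 : vars s2 vx = w by rewrite (frame_var fr2).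
have vp2 : vars s2 vp = v by rewrite (frame_var fr2).
apply: wp_weaken (charge_parentP tab2 nw vx2 vp2 vb2) => //.
rewrite /= cost2 sel2; rewrite cost1 in b_min.
set F := mat (arrs s' Acost) in b_min *.
pose pick u := if (nxt w u == v) && (F w b < F w u) then b else u.
move=> s3 [sel3 cost3]; pose F3 := mat (arrs s3 Acost).
have {}sel3 x u : mat (arrs s3 Asel) x u =
    if x == w then (pick u : nat) else mat (arrs s' Asel) x u := sel3 x u.
have {}cost3 x u : F3 x u = if x == v then F x u + F w (pick u) else F x u := cost3 x u.
have choiceE x u : choice s3 x u = if x == w then pick u else choice s' x u.
  by rewrite /choice sel3; case: eqP; rewrite ?to_vertexK.
(* This round changes only the row of the parent [v], which is older than [w] and still unprocessed;
   the rows of processed vertices are final. *)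
have F3D x u : D i.+1 x -> F3 x u = F x u.
  move=> Dx; rewrite cost3; case: eqP => // E.
  by rewrite E Dv in Dx.
split.
- move=> x u; rewrite -/F3.
  have -> : \sum_(y | D i.+1 y && (nxt y root == x)) F3 y (choice s3 y u) =
      \sum_(y | D i y && (nxt y root == x)) F y (choice s' y u) +
      (if x == v then F w (pick u) else 0).
    rewrite (eq_bigr (fun y => F y (if y == w then pick u else choice s' y u)));
      last by move=> y /andP[Dy _]; rewrite F3D // choiceE.
    have E : \sum_(y | D i y && (nxt y root == x))
        F y (if y == w then pick u else choice s' y u) =
      \sum_(y | D i y && (nxt y root == x)) F y (choice s' y u).
      by apply: eq_bigr => y /andP[Dy _]; case: eqP => // yw; rewrite yw Dw in Dy.
    rewrite -E; have [->|nxv] := eqVneq x v.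
      rewrite (bigD1 w) /=; last by rewrite D_S !eqxx.
      rewrite eqxx addnC; congr (_ + _); apply: eq_bigl => y; rewrite D_S.
      by have [->|ny] := eqVneq y w; rewrite ?Dw ?andbF ?andbT.
    rewrite addn0; apply: eq_bigl => y; rewrite D_S.
    have [->|//] := eqVneq y w; rewrite Dw /=.
    by rewrite eq_sym -/v (negbTE nxv).
  rewrite cost3 addnA -old1 -/F.
  by case: eqP => // _; rewrite addn0.
- move=> x Dx u; rewrite choiceE -/F3; have := Dx; rewrite D_S.
  have [-> _|nxw /= Dx'] := eqVneq x w; last first.
    have [c m] := old2 x Dx' u; split=> // y /m.
    by rewrite !F3D.
  have T := nav_turn nav u ewv.
  have F3w y : F3 w y = F w y by apply: F3D; rewrite D_S eqxx.
  rewrite -/v in b_in b_min *; split.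
    rewrite /pick; case: ifP => [/andP[E _]|_]; last by rewrite /compatible eqxx.
    by rewrite /compatible b_in T E orbT.
  (* An admissible competitor is either [u] itself or a source inside the subtree of [w] while [u]
     lies outside; the latter is beaten by [b]. *)
  move=> y; rewrite !F3w /compatible /pick => /orP[/eqP ->|/andP[ny]].
    by case: ifP => // /andP[_ /ltnW].
  rewrite T negbK => E; rewrite -/v E /=.
  by have := b_min y ny; case: ltnP => //; lia.
move=> x u; rewrite D_S sel3 choiceE; case: eqP => //= _.
exact: old3.
Qed.

Lemma best_rootP s :
  tables s -> vars s vbest = 0 ->
  wp best_root n (fun s' => exists2 b : V, vars s' vbest = b &
    forall u, mat (arrs s Acost) root b <= mat (arrs s Acost) root u) s.
Proof.
move=> tab vb; pose F := mat (arrs s Acost) root.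
pose I i s' := exists2 b : V, vars s' vbest = b & forall u : V, u < i -> F b <= F u.
apply: (@wp_weaken _ n n (I n)) => //.
  by move=> s' [b b1 b2]; exists b => // u; apply: b2.
apply: (@wp_for _ _ _ _ n 1) => //; rewrite ?muln1 ?n_gt0 ?(input_n (tables_input tab)) //.
  by exists root.
move=> i s' lt xi [b b1 b2] fr; pose u := Ordinal lt.
have tab' := tables_frame fr isT isT tab.
have row : arrs s' Arow 0 = root * n by rewrite (tables_rows tab') ?n_gt0.
have cost (v : V) : arrs s' Acost (root * n + v) = F v by rewrite (frame_arr fr).
apply: wp_run => //=; rewrite b1 xi row (cost b) (cost u).
have split_lt (u' : V) : u' < i.+1 -> u' = u \/ u' < i.
  by rewrite ltnS leq_eqVlt => /orP[/eqP E|]; [left; apply: val_inj | right].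
have [ltF|geF] /= := ltnP (F u) (F b).
  exists u => //= u' /split_lt[->|/b2 le] //; exact: leq_trans (ltnW ltF) le.
by exists b => // u' /split_lt[->|/b2].
Qed.

Lemma traceP s (sel : V -> V -> V) (b : V) :
  tables s -> arrs s Asource 0 = b ->
  (forall w u, w != root -> mat (arrs s Asel) w u = sel w u) ->
  wp trace n (fun s' => exists a : V -> V,
    [/\ forall v : V, arrs s' Asource v = a v, a root = b
      & forall w, w != root -> a w = sel w (a (nxt w root))]) s.
Proof.
move=> tab b0 sels.
pose I i s' := exists a : V -> V,
    [/\ forall v : V, rank h v <= i -> arrs s' Asource v = a v, a root = b
      & forall w, rank h w <= i -> w != root -> a w = sel w (a (nxt w root))].
have le_last v : rank h v <= n.-1 by rewrite -h_size rank_size.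
apply: (@wp_weaken _ n n (I n.-1)) => //.
  by move=> s' [a [a1 a2 a3]]; exists a; split=> // v; [apply: a1 | apply: a3].
apply: (@wp_for _ _ _ _ n.-1 1) => //;
  rewrite ?muln1 ?n_gt0 ?leq_pred ?(tables_last tab) //.
  (* Only the root has rank 0, so any function with value [b] there will do. *)
  exists (fun _ => b); split=> // v; rewrite leqn0 eqn0Ngt rank_gt0 negbK.
    by move=> /eqP ->.
  by move=> ->.
move=> i s' lt xi [a [a1 a2 a3]] fr.
have tab' := tables_frame fr isT isT tab.
have [w rw] : exists w, rank h w = i.+1 by apply: rank_onto; lia.
have nw : w != root by rewrite -rank_gt0 rw.
have rv : rank h (nxt w root) <= i.
  by have := rank_nx g (dom_full w) nw; rewrite rw.
have row : arrs s' Arow w = w * n by rewrite (tables_rows tab').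
apply: wp_run => //; set s2 := run _ _.
have S2 : forall k, arrs s2 Asource k =
    if k == w then (sel w (a (nxt w root)) : nat) else arrs s' Asource k.
  move=> k; rewrite /s2 /= xi addn1 -rw (tables_order tab') row.
  have -> : arrs s' Anext (w * n + 0) = nxt w root := tables_next tab' w root.
  rewrite a1 // [arrs s' Asel](frame_arr fr) //.
  by have := sels w (a (nxt w root)) nw; rewrite /mat => ->.
have rank_eq v : rank h v <= i.+1 -> v = w \/ rank h v <= i /\ v != w.
  rewrite leq_eqVlt => /orP[/eqP E|lev].
    by left; apply: (rank_inj g); rewrite ?dom_full // E.
  by right; split=> //; apply: contraTneq lev => ->; rewrite rw ltnn.
clearbody s2.
have nxw x : rank h x <= i -> x == w = false.
  by move=> le; apply/negbTE; apply: contraTneq le => ->; rewrite rw ltnn.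
(* Redefining [a] at [w] leaves the vertices of rank at most [i] untouched, and with them all
   parents concerned. *)
exists (fun v => if v == w then sel w (a (nxt w root)) else a v); split.
- move=> v le; rewrite S2 -[(v : nat) == w]/(v == w).
  by case: (rank_eq v le) => [->|[le' /negbTE ->]]; rewrite ?eqxx // a1.
- by rewrite nxw // (rank_root g).
move=> v le nv; rewrite (nxw (nxt v root)); last first.
  by rewrite -ltnS; apply: leq_trans (rank_nx g (dom_full v) nv) le.
case: (rank_eq v le) => [->|[le' /negbTE ->]]; rewrite ?eqxx //.
exact: a3.
Qed.

Lemma outputP s (a : V -> V) :
  tables s -> (forall v : V, arrs s Asource v = a v) ->
  (forall i, arrs s Amat i = 0) -> (forall i, arrs s Astored i = 0) ->
  wp output n (fun s' => output_solution es s' = assignment_solution nxt a) s.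
Proof.
move=> tab src mat0 sto0.
pose id v := index (nxt v (a v), v) es.
pose I i s' := (forall v : V, (arrs s' Amat v != 0) = (v < i) && (a v == v)) /\
  (forall k, (arrs s' Astored k != 0) =
     [exists v : V, [&& v < i, a v != v & id v == k]]).
have in_es v : a v != v -> (nxt v (a v), v) \in es.
  by move=> nv; rewrite listing.2; apply: (nav_edge nav).
apply: (@wp_weaken _ n n (I n)) => //.
  move=> s' [I1 I2]; congr Solution; apply/setP => x; rewrite !inE.
    by rewrite I1 ltn_ord.
  rewrite I2; apply/andP/imsetP => [[xes /existsP[v /and3P[_ nv /eqP E]]]|[v]].
    exists v; rewrite ?inE // -(nth_index x xes) -E.
    by rewrite nth_index // in_es.
  rewrite inE => nv ->; split; first exact: in_es.
  by apply/existsP; exists v; rewrite ltn_ord nv /=.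
apply: (@wp_for _ _ _ _ n 1) => //; rewrite ?muln1 ?n_gt0 ?(input_n (tables_input tab)) //.
  split=> [v|k]; rewrite ?mat0 ?sto0 //.
  by apply/esym/negbTE/existsPn => v.
move=> i s' lt xi [I1 I2] fr; pose v := Ordinal lt.
have tab' := tables_frame fr isT isT tab.
have row (x : V) : arrs s' Arow x = x * n by rewrite (tables_rows tab').
have src' : arrs s' Asource i = a v by rewrite (frame_arr fr) // (src v).
have lt_i (u : V) : (u < i.+1) = (u == v) || (u < i).
  by rewrite ltnS leq_eqVlt -val_eqE.
have ltvF : v < i = false by rewrite ltnn.
apply: wp_run => //=; rewrite xi src' -[_ == i]/(a v == v).
have [av|nv] /= := eqVneq (a v) v; rewrite ?xi.
  split=> [u|k] /=.
    rewrite -[(u : nat) == i]/(u == v) lt_i.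
    by case: (eqVneq u v) => [->|ne] //=; rewrite ?av ?eqxx // I1.
  rewrite I2; apply: eq_existsb => u; rewrite lt_i.
  by case: (eqVneq u v) => [->|ne] //=; rewrite av eqxx !andbF.
split=> [u|k] /=.
  rewrite I1 lt_i.
  by case: (eqVneq u v) => [->|ne] //=; rewrite (negbTE nv) andbF.
rewrite ?src' (row v) (tables_next tab' v (a v)) row.
rewrite (edge_lookup (tables_edges tab') (nav_edge nav nv)) -/(id v).
have [->|/eqP ne] /= := eqVneq k (id v).
  by apply/esym/existsP; exists v; rewrite lt_i eqxx nv /=.
rewrite I2; apply: eq_existsb => u; rewrite lt_i.
case: (eqVneq u v) => [->|//] /=; rewrite ltvF.
by apply/esym/negbTE; rewrite negb_and; apply/orP; right; apply/eqP/nesym.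
Qed.

End Grown.

(** * The complete run *)

Lemma bmr_programP :
  wp bmr_program (n * n) (fun s' => bmr_optimal G Rb (output_solution es s'))
    (input_state G Rb es).
Proof.
set s0 := input_state G Rb es.
have nn : 0 < n * n by rewrite muln_gt0 n_gt0.
have n_nn : n <= n * n by rewrite leq_pmulr ?n_gt0.
have zero a i : 4 < a -> arrs s0 a i = 0.
  by rewrite /s0 /=; do 5?case: a => [|a] //; rewrite nth_nil.
have inp0 : input s0 by [].
apply: wp_seq => //; apply: wp_run => //; set s1 := run _ _.
have fr1 : frame [:: vlast; vpen] [::] s0 s1.
  by split=> // k; rewrite !inE !negb_or /s1 /=; do !case: eqP => //= _.
have last1 : vars s1 vlast = n.-1 by rewrite /s1 /= subn1.
have [pen1 acc1 vx1] : [/\ vars s1 vpen = 1, vars s1 vacc = 0 & vars s1 vx = 0] by [].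
clearbody s1; have inp1 := input_frame fr1 isT isT inp0.
have zero1 a i : 4 < a -> arrs s1 a i = 0 by move=> lt; rewrite (frame_arr fr1) ?zero.
apply: wp_seq => //; apply: (wp_weaken n_nn _ (wp_frame (init_rowsP inp1 acc1 pen1))).
move=> s2 [[rows2 pen2] fr2]; have inp2 := input_frame fr2 isT isT inp1.
apply: wp_seq => //.
apply: wp_weaken (leqnn _) _ (wp_frame (init_edgesP inp2 rows2 _)); last first.
  by move=> i; rewrite (frame_arr fr2) // zero1.
move=> s3 [edges3 fr3]; have inp3 := input_frame fr3 isT isT inp2.
apply: wp_seq => //; apply: wp_run => //; set s4 := run _ _.
have fr4 : frame [::] [:: Aseen] s3 s4.
  by split=> // k; rewrite !inE /s4 /=; case: eqP.
have seen4 i : arrs s4 Aseen i = (i == 0).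
  rewrite /s4 /=; case: eqP => // _.
  by rewrite (frame_arr fr3) // (frame_arr fr2) // zero1.
clearbody s4; have inp4 := input_frame fr4 isT isT inp3.
have rows4 : rows_ok (arrs s4 Arow) by rewrite (frame_arr fr4) // (frame_arr fr3).
have edges4 : edges_ok (arrs s4 Aedge) by rewrite (frame_arr fr4).
have last4 : vars s4 vlast = n.-1.
  by rewrite (frame_var fr4) // (frame_var fr3) // (frame_var fr2).
have vx4 : vars s4 vx = 0.
  by rewrite (frame_var fr4) // (frame_var fr3) // (frame_var fr2).
have pen4 : vars s4 vpen = penalty G by rewrite (frame_var fr4) // (frame_var fr3).
have zero4 a i : a \in [:: Amat; Astored; Acand; Aorder; Anext; Adist] ->
    arrs s4 a i = 0.
  move=> ain; rewrite (frame_arr fr4) ?(frame_arr fr3) ?(frame_arr fr2) ?zero1 //;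
  by move: ain; rewrite !inE; do 5?case/orP; move/eqP=> ->.
apply: wp_seq => //.
apply: wp_weaken (leqnn _) _
  (wp_frame (growP inp4 rows4 edges4 last4 vx4 seen4 _)); last first.
  by move=> a i ain; apply: zero4; move: ain; rewrite !inE; do 3?case/orP; move/eqP=> ->.
move=> s5 [[h [h_size [g ord5 maps5]]] fr5].
have full := dom_full g h_size.
have tab5 : tables h s5.
  split.
  - exact: input_frame fr5 isT isT inp4.
  - by rewrite (frame_arr fr5).
  - by rewrite (frame_arr fr5).
  - by move=> v; apply: ord5.
  - by move=> u v; have [] := maps5 v u (full v) (full u).
  - by rewrite (frame_var fr5).
have dist5 (u v : V) : arrs s5 Adist (u * n + v) = dist ret h u v.
  by have [_] := maps5 u v (full u) (full v).
have pen5 : vars s5 vpen = penalty G by rewrite (frame_var fr5).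
apply: wp_seq => //.
apply: wp_weaken (leqnn _) _ (wp_frame (init_costsP g h_size tab5 pen5 dist5)).
move=> s6 [cost6 fr6]; have tab6 := tables_frame fr6 isT isT tab5.
apply: wp_seq => //.
apply: wp_weaken (leqnn _) _ (wp_frame (sweepP g h_size tab6 cost6)).
move=> s7 [[F_eq sel_ok7 val7] fr7]; have tab7 := tables_frame fr7 isT isT tab6.
apply: wp_seq => //; apply: wp_run => //; set s8 := run _ _.
have fr8 : frame [:: vbest] [::] s7 s8.
  by split=> // k; rewrite !inE /s8 /=; case: eqP.
have best8 : vars s8 vbest = 0 by [].
clearbody s8; have tab8 := tables_frame fr8 isT isT tab7.
apply: wp_seq => //; apply: (wp_weaken n_nn _ (wp_frame (best_rootP tab8 best8))).
move=> s9 [[b vb9 b_min] fr9]; have tab9 := tables_frame fr9 isT isT tab8.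
apply: wp_seq => //; apply: wp_run => //; set s10 := run _ _.
have fr10 : frame [::] [:: Asource] s9 s10.
  by split=> // k; rewrite !inE /s10 /=; case: eqP.
have src10 : arrs s10 Asource 0 = b by rewrite /s10 /= vb9.
clearbody s10; have tab10 := tables_frame fr10 isT isT tab9.
have sel10 w u : w != root -> mat (arrs s10 Asel) w u = choice s7 w u.
  move=> nw; rewrite (frame_arr fr10) // (frame_arr fr9) // (frame_arr fr8) //.
  exact: val7.
apply: wp_seq => //.
apply: (wp_weaken n_nn _ (wp_frame (traceP g h_size tab10 src10 sel10))).
move=> s11 [[a [src11 a_root a_step]] fr11].
have tab11 := tables_frame fr11 isT isT tab10.
have zero11 c i : c \in [:: Amat; Astored] -> arrs s11 c i = 0.
  move=> cin; have {}cin : c = Amat \/ c = Astored.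
    by move: cin; rewrite !inE => /orP[] /eqP; [left | right].
  case: cin => ->; rewrite (frame_arr fr11) // (frame_arr fr10) // (frame_arr fr9) //;
  by rewrite (frame_arr fr8) // (frame_arr fr7) // (frame_arr fr6) // (frame_arr fr5) // zero4.
apply: wp_weaken n_nn _ (outputP g h_size tab11 src11 _ _) => [s12 ->|i|i];
  [|exact: zero11|exact: zero11].
(* The abstract recursion is instantiated with the contents of [Acost] and [Asel] at the end of
   [sweep]. *)
apply: (dynamic_program_optimal (nav g h_size) F_eq) => //.
- by move=> w u nw; have [] := sel_ok7 w nw u.
- by move=> w u x nw cx; have [_] := sel_ok7 w nw u; apply.
move=> u; rewrite a_root; have := b_min u.
by rewrite (frame_arr fr8).
Qed.

End Correctness.

Theorem theorem8 :
  exists (prog : cmd) (C : nat),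
  forall (n : nat) (G : version_graph 'I_n) (Rb : nat)
         (es : seq ('I_n * 'I_n)),
    bidirectional_tree G -> edge_listing G es ->
    exists (st : state) (t : nat),
      [/\ exec prog (input_state G Rb es) st t,
          t <= C * n ^ 2
        & bmr_optimal G Rb (output_solution es st)].
Proof.
(* The constant is read off the program text and is thus independent of the instance. *)
exists bmr_program, (weight bmr_program) => n G Rb es tree listing.
have [st [t [ex le opt]]] := bmr_programP Rb tree listing.
by exists st, t; rewrite -mulnn.
Qed.
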